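(* The invertible sheaves (of rank $1|0$) on $\mathbb{P}^{1|m}$ are generated by the following transition functions on $\mathcal{U}\cap\mathcal{V}$: $$ \mathrm{Pic}_0(\mathbb{P}^{1|m})\cong\left\langle\ w^k,\quad 1+\sum_{j=1}^{\lfloor m/2\rfloor}\ \sum_{|[\underline{s}]|=2j}\ \sum_{\ell=1}^{2j-1}c_\ell^{[\underline{s}]}\,\frac{\psi^{[\underline{s}]}}{w^\ell}\ \right\rangle, $$ where $k\in\mathbb{Z}$ and $c_\ell^{[\underline{s}]}\in\mathbb{C}$ for each multi-index $[\underline{s}]$ with $|[\underline{s}]|=2j$, $1\le j\le\lfloor m/2\rfloor$, and each $\ell=1,\ldots,|[\underline{s}]|-1$. That is, $\mathrm{Pic}_0(\mathbb{P}^{1|m})\cong H^1(\mathcal{O}^*_{\mathbb{P}^{1|m},0})$ is generated by the classes of these $1$-cocycles.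
   Context: $\mathbb{P}^{1|m}$ is the complex projective superspace of dimension $1|m$, covered by two affine charts $\mathcal{U}$ with coordinates $(z|\theta_1,\ldots,\theta_m)$ and $\mathcal{V}$ with coordinates $(w|\psi_1,\ldots,\psi_m)$, related on $\mathcal{U}\cap\mathcal{V}$ by $z=1/w$, $\theta_i=\psi_i/w$. $\mathrm{Pic}_0$ is the group of isomorphism classes of locally-free sheaves of rank $1|0$, isomorphic to $H^1(\mathcal{O}^*_{\mathbb{P}^{1|m},0})$, where $\mathcal{O}^*_{\mathbb{P}^{1|m},0}$ is the sheaf of abelian groups of even invertible sections of the structure sheaf. A multi-index is $[\underline{s}]=(i_1,\ldots,i_m)$ with $i_k\in\{0,1\}$; $|[\underline{s}]|=\sum_k i_k$ and $\psi^{[\underline{s}]}=\psi_1^{i_1}\cdots\psi_m^{i_m}$ (with $\psi_k^0=1$). *)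

(* Defs.v *)
From HB Require Import structures.
From mathcomp Require Import all_boot all_order all_algebra complex ring zify.

Set Implicit Arguments.
Unset Strict Implicit.
Unset Printing Implicit Defensive.

Import Order.TTheory GRing.Theory Num.Theory.
Local Open Scope ring_scope.

Section ExteriorAlgebra.
Variables (K : fieldType) (m : nat).
Implicit Types (A B C S : {set 'I_m}).

(* The exterior algebra on m odd generators: [a S] is the coefficient in [a] *)
(* of the monomial theta_{i_1} ... theta_{i_r}, where i_1 < ... < i_r        *)
(* enumerates S. It is not given the pointwise product of {ffun _ -> _}.     *)
Definition ext : Type := {ffun {set 'I_m} -> K}.
HB.instance Definition _ := GRing.Zmodule.copy ext {ffun {set 'I_m} -> K}.

Definition ext_scale (k : K) (a : ext) : ext := [ffun S => k * a S].

Lemma ext_scaleA k l a : ext_scale k (ext_scale l a) = ext_scale (k * l) a.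
Proof. by apply/ffunP => S; rewrite !ffunE mulrA. Qed.

Lemma ext_scale1 : left_id 1 ext_scale.
Proof. by move=> a; apply/ffunP => S; rewrite !ffunE mul1r. Qed.

Lemma ext_scaleDr : right_distributive ext_scale +%R.
Proof. by move=> k a b; apply/ffunP => S; rewrite !ffunE mulrDr. Qed.

Lemma ext_scaleDl a : {morph ext_scale^~ a : k l / k + l}.
Proof. by move=> k l; apply/ffunP => S; rewrite !ffunE mulrDl. Qed.

HB.instance Definition _ := GRing.Zmodule_isLmodule.Build K ext
  ext_scaleA ext_scale1 ext_scaleDr ext_scaleDl.

Lemma extZE (k : K) (a : ext) S : (k *: a) S = k * a S.
Proof. by rewrite [LHS]ffunE. Qed.

(* theta^A theta^B = (-1)^(inversions A B) theta^(A :|: B) for disjoint A, B *)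
Definition inversions A B : nat := (\sum_(i in A) \sum_(j in B) (j < i))%N.

Definition shuffle_sign A B : K :=
  if [disjoint A & B] then (-1) ^+ inversions A B else 0.

Definition ext_one : ext := [ffun S => (S == set0)%:R].
Definition ext_mul (a b : ext) : ext :=
  [ffun S => \sum_A \sum_(B | A :|: B == S) shuffle_sign A B * (a A * b B)].

Lemma sum_disjointU A B (F : 'I_m -> nat) : [disjoint A & B] ->
  (\sum_(i in A :|: B) F i = \sum_(i in A) F i + \sum_(i in B) F i)%N.
Proof.
move=> dAB; rewrite -bigU //=.
by apply: eq_bigl => i; rewrite !inE.
Qed.

Lemma inversionsUl A B C : [disjoint A & B] ->
  inversions (A :|: B) C = (inversions A C + inversions B C)%N.
Proof. by move=> dAB; rewrite /inversions sum_disjointU. Qed.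

Lemma inversionsUr A B C : [disjoint B & C] ->
  inversions A (B :|: C) = (inversions A B + inversions A C)%N.
Proof.
move=> dBC; rewrite /inversions -big_split /=.
by apply: eq_bigr => i _; rewrite sum_disjointU.
Qed.

Lemma shuffle_signA A B C :
  shuffle_sign A B * shuffle_sign (A :|: B) C =
  shuffle_sign B C * shuffle_sign A (B :|: C).
Proof.
rewrite /shuffle_sign.
have dl : [disjoint A :|: B & C] = [disjoint A & C] && [disjoint B & C].
  by rewrite -!setI_eq0 setIUl setU_eq0.
have dr : [disjoint A & B :|: C] = [disjoint A & B] && [disjoint A & C].
  by rewrite -!setI_eq0 setIUr setU_eq0.
rewrite dl dr.
have [dAB|] := boolP [disjoint A & B]; last by rewrite !(mul0r, mulr0).
have [dAC|] := boolP [disjoint A & C]; last by rewrite !(mul0r, mulr0).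
have [dBC|] := boolP [disjoint B & C]; last by rewrite !(mul0r, mulr0).
by rewrite /= inversionsUl // inversionsUr // -!exprD; congr (_ ^+ _); lia.
Qed.

Lemma ext_mulA : associative ext_mul.
Proof.
move=> a b c; apply/ffunP => S; rewrite !ffunE.
pose T A B C := shuffle_sign A B * shuffle_sign (A :|: B) C * (a A * b B * c C).
transitivity (\sum_A \sum_B \sum_(C | A :|: B :|: C == S) T A B C).
  apply: eq_bigr => A _.
  under eq_bigr => D _ do rewrite ffunE !mulr_sumr.
  rewrite (exchange_big_dep predT) //=; apply: eq_bigr => B _.
  under eq_bigr => D _ do rewrite !mulr_sumr.
  rewrite (exchange_big_dep predT) //= [RHS]big_mkcond /=; apply: eq_bigr => C _.
  under eq_bigl => D do rewrite andbC eq_sym.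
  rewrite big_mkcondr big_pred1_eq setUA.
  case: (A :|: B :|: C == S) => //; rewrite /T shuffle_signA; ring.
apply/esym.
transitivity (\sum_D \sum_C \sum_A \sum_(B | A :|: B == D)
   (if D :|: C == S then T A B C else 0)).
  apply: eq_bigr => D _; rewrite big_mkcond; apply: eq_bigr => C _.
  case: ifP => _; last by rewrite big1 // => A _; rewrite big1.
  rewrite ffunE mulr_suml mulr_sumr; apply: eq_bigr => A _.
  rewrite mulr_suml mulr_sumr; apply: eq_bigr => B /eqP <-.
  by rewrite /T; ring.
rewrite exchange_big /=.
under eq_bigr => C _ do rewrite exchange_big /=.
rewrite exchange_big /=; apply: eq_bigr => A _.
rewrite [RHS](eq_bigr (fun B => \sum_C if A :|: B :|: C == S then T A B C else 0));
  last by move=> B _; rewrite big_mkcond.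
rewrite [RHS]exchange_big /=; apply: eq_bigr => C _.
rewrite (exchange_big_dep predT) //=; apply: eq_bigr => B _.
by under eq_bigl => D do rewrite eq_sym; rewrite big_pred1_eq.
Qed.

Lemma ext_mul1l : left_id ext_one ext_mul.
Proof.
move=> a; apply/ffunP => S; rewrite ffunE (bigD1 set0) //= [X in _ + X]big1.
  rewrite addr0 (eq_bigl (pred1 S)); last by move=> B; rewrite set0U.
  rewrite big_pred1_eq ffunE eqxx mul1r /shuffle_sign.
  by rewrite -setI_eq0 set0I eqxx /inversions big_set0 mul1r.
by move=> A nA; rewrite big1 // => B _; rewrite ffunE (negPf nA) mul0r mulr0.
Qed.

Lemma ext_mul1r : right_id ext_one ext_mul.
Proof.
move=> a; apply/ffunP => S; rewrite ffunE.
rewrite (exchange_big_dep predT) //= (bigD1 set0) //= [X in _ + X]big1.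
  rewrite addr0 (eq_bigl (pred1 S)); last by move=> B; rewrite setU0.
  rewrite big_pred1_eq ffunE eqxx mulr1 /shuffle_sign.
  rewrite -setI_eq0 setI0 eqxx /inversions big1 ?mul1r // => i _.
  by rewrite big_set0.
by move=> A nA; rewrite big1 // => B _; rewrite ffunE (negPf nA) mulr0 mulr0.
Qed.

Lemma ext_mulDl : left_distributive ext_mul +%R.
Proof.
move=> a b c; apply/ffunP => S; rewrite !ffunE -big_split; apply: eq_bigr => A _.
by rewrite -big_split; apply: eq_bigr => B _; rewrite /= !ffunE -mulrDr mulrDl.
Qed.

Lemma ext_mulDr : right_distributive ext_mul +%R.
Proof.
move=> a b c; apply/ffunP => S; rewrite !ffunE -big_split; apply: eq_bigr => A _.
by rewrite -big_split; apply: eq_bigr => B _; rewrite /= !ffunE !mulrDr.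
Qed.

Lemma ext_one_neq0 : ext_one != 0.
Proof.
by apply/eqP => /ffunP/(_ set0); rewrite !ffunE eqxx => /eqP; rewrite oner_eq0.
Qed.

HB.instance Definition _ := GRing.Zmodule_isNzRing.Build ext
  ext_mulA ext_mul1l ext_mul1r ext_mulDl ext_mulDr ext_one_neq0.

Lemma ext_scaleAl (k : K) (a b : ext) : k *: (a * b) = (k *: a) * b.
Proof.
apply/ffunP => S; rewrite extZE !ffunE mulr_sumr; apply: eq_bigr => A _.
rewrite mulr_sumr; apply: eq_bigr => B _.
by rewrite extZE; ring.
Qed.

Lemma ext_scaleAr (k : K) (a b : ext) : k *: (a * b) = a * (k *: b).
Proof.
apply/ffunP => S; rewrite extZE !ffunE mulr_sumr; apply: eq_bigr => A _.
rewrite mulr_sumr; apply: eq_bigr => B _.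
by rewrite extZE; ring.
Qed.

HB.instance Definition _ := GRing.Lmodule_isLalgebra.Build K ext ext_scaleAl.
HB.instance Definition _ := GRing.Lalgebra_isAlgebra.Build K ext ext_scaleAr.

Lemma ext1E S : (1 : ext) S = (S == set0)%:R.
Proof. by rewrite [LHS]ffunE. Qed.

Lemma extME (a b : ext) S :
  (a * b) S = \sum_A \sum_(B | A :|: B == S) shuffle_sign A B * (a A * b B).
Proof. by rewrite [LHS]ffunE. Qed.

Lemma extDE (a b : ext) S : (a + b) S = a S + b S.
Proof. by rewrite [LHS]ffunE. Qed.

Lemma ext_sumE (I : Type) (r : seq I) (P : pred I) (f : I -> ext) S :
  (\sum_(i <- r | P i) f i) S = \sum_(i <- r | P i) f i S.
Proof. by rewrite [LHS]sum_ffunE. Qed.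

Definition ext_gen (i : 'I_m) : ext := [ffun S => (S == [set i])%:R].

(* psi_1^{i_1} ... psi_m^{i_m}, with the multi-index (i_1, ..., i_m) encoded *)
(* by S = {k | i_k = 1}.                                                     *)
Definition ext_monomial S : ext := \prod_(i < m) ext_gen i ^+ (i \in S).

Definition ext_even (a : ext) : Prop := forall S, odd #|S| -> a S = 0.

Lemma inversionsC A B : [disjoint A & B] ->
  (inversions A B + inversions B A)%N = (#|A| * #|B|)%N.
Proof.
move=> dAB; rewrite /inversions [X in (_ + X)%N]exchange_big -big_split /=.
rewrite -sum_nat_const; apply: eq_bigr => i iA.
rewrite -big_split -sum1_card /=; apply: eq_bigr => j jB.
suff : i != j :> nat by lia.
apply: contraTneq jB => /val_inj <-.
by rewrite (disjointFr dAB iA).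
Qed.

Lemma shuffle_signC A B : ~~ odd #|A| -> shuffle_sign A B = shuffle_sign B A.
Proof.
move=> eA; rewrite /shuffle_sign disjoint_sym; case: ifP => // dAB.
rewrite disjoint_sym in dAB.
rewrite -signr_odd -[RHS]signr_odd; congr (_ ^+ nat_of_bool _).
have := congr1 odd (inversionsC dAB).
by rewrite oddD oddM (negPf eA) /=; case: odd; case: odd.
Qed.

Lemma ext_evenC (a b : ext) : ext_even a -> a * b = b * a.
Proof.
move=> ea; apply/ffunP => S; rewrite !extME (exchange_big_dep predT) //=.
apply: eq_bigr => B _; apply: eq_big => [A|A _]; first by rewrite setUC.
have [oA|eA] := boolP (odd #|A|); first by rewrite ea // !(mul0r, mulr0).
by rewrite shuffle_signC // (mulrC (a A)).
Qed.

Lemma ext_even1 : ext_even 1.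
Proof.
move=> S oS; rewrite ext1E; case: eqP oS => // ->.
by rewrite cards0.
Qed.

Lemma ext_evenM a b : ext_even a -> ext_even b -> ext_even (a * b).
Proof.
move=> ea eb S oS; rewrite extME big1 // => A _; rewrite big1 // => B /eqP AB.
have [oA|eA] := boolP (odd #|A|); first by rewrite ea // mul0r mulr0.
have [oB|eB] := boolP (odd #|B|); first by rewrite eb // mulr0 mulr0.
rewrite /shuffle_sign; case: ifP => [dAB|_]; last by rewrite mul0r.
move: oS; rewrite -AB cardsU (disjoint_setI0 dAB) cards0 subn0 oddD.
by rewrite (negPf eA) (negPf eB).
Qed.

Lemma ext_evenD a b : ext_even a -> ext_even b -> ext_even (a + b).
Proof. by move=> ea eb S oS; rewrite extDE ea // eb // addr0. Qed.

Lemma ext_evenZ (k : K) a : ext_even a -> ext_even (k *: a).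
Proof. by move=> ea S oS; rewrite extZE ea // mulr0. Qed.

Lemma ext_even_sum (I : Type) (r : seq I) (P : pred I) (f : I -> ext) :
  (forall i, P i -> ext_even (f i)) -> ext_even (\sum_(i <- r | P i) f i).
Proof. by move=> ef S oS; rewrite ext_sumE big1 // => i /ef; exact. Qed.

Lemma ext_evenX a n : ext_even a -> ext_even (a ^+ n).
Proof.
move=> ea; elim: n => [|n IHn]; first by rewrite expr0; exact: ext_even1.
by rewrite exprS; exact: ext_evenM.
Qed.

Definition ext_order_ge d (a : ext) := forall S, (#|S| < d)%N -> a S = 0.

Lemma ext_order_geM d d' a b :
  ext_order_ge d a -> ext_order_ge d' b -> ext_order_ge (d + d') (a * b).
Proof.
move=> ga gb S hS; rewrite extME big1 // => A _; rewrite big1 // => B /eqP AB.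
rewrite /shuffle_sign; case: ifP => [dAB|_]; last by rewrite mul0r.
move: hS; rewrite -AB cardsU (disjoint_setI0 dAB) cards0 subn0 => hS.
case: (ltnP #|A| d) => hA; first by rewrite ga // mul0r mulr0.
by rewrite gb ?mulr0 //; lia.
Qed.

Lemma ext_nilpotent a : ext_order_ge 1 a -> a ^+ m.+1 = 0.
Proof.
move=> ga; have ge n : ext_order_ge n (a ^+ n).
  by elim: n => // n IHn; rewrite exprS -add1n; exact: ext_order_geM.
apply/ffunP => S; rewrite ge ?ffunE // ltnS.
by rewrite (leq_trans (max_card _)) // card_ord.
Qed.

Definition ext_homogeneous d (a : ext) := forall S, #|S| != d -> a S = 0.

Lemma ext_homogeneousM d d' a b : ext_homogeneous d a ->
  ext_homogeneous d' b -> ext_homogeneous (d + d') (a * b).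
Proof.
move=> ha hb S hS; rewrite extME big1 // => A _; rewrite big1 // => B /eqP AB.
rewrite /shuffle_sign; case: ifP => [dAB|_]; last by rewrite mul0r.
move: hS; rewrite -AB cardsU (disjoint_setI0 dAB) cards0 subn0 => hS.
have [hA|hA] := eqVneq #|A| d; last by rewrite ha // mul0r mulr0.
by rewrite hb ?mulr0 //; lia.
Qed.

Lemma ext_monomial_homogeneous S : ext_homogeneous #|S| (ext_monomial S).
Proof.
rewrite -sum1_card big_mkcond /ext_monomial.
apply: (big_ind2 (fun d a => ext_homogeneous d a)).
- by move=> T hT; rewrite ext1E; case: (T =P set0) hT => // ->; rewrite cards0.
- by move=> *; exact: ext_homogeneousM.
- move=> i _; case: (i \in S) => T hT.
    by rewrite ffunE; case: (T =P [set i]) hT => // ->; rewrite cards1.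
  by rewrite ext1E; case: (T =P set0) hT => // ->; rewrite cards0.
Qed.

(* The substitution theta_i := psi_i / w. *)
Definition ext_rescale (w : K) (a : ext) : ext :=
  [ffun S : {set _} => w ^- #|S| * a S].

Lemma ext_rescale1 w : ext_rescale w 1 = 1.
Proof.
apply/ffunP => S; rewrite ffunE !ext1E; case: eqP => [->|_]; rewrite ?mulr0 //.
by rewrite cards0 expr0 invr1 mulr1.
Qed.

Lemma ext_rescaleM w a b :
  ext_rescale w (a * b) = ext_rescale w a * ext_rescale w b.
Proof.
apply/ffunP => S; rewrite !(ffunE, extME) mulr_sumr; apply: eq_bigr => A _.
rewrite mulr_sumr; apply: eq_bigr => B /eqP AB; rewrite !ffunE /shuffle_sign.
case: ifP => [dAB|_]; last by rewrite !(mul0r, mulr0).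
rewrite -AB cardsU (disjoint_setI0 dAB) cards0 subn0 exprD invfM; ring.
Qed.

End ExteriorAlgebra.

Arguments ext_gen {K m} i.
Arguments ext_monomial {K m} S.

From mathcomp Require Import boolp classical_sets functions reals topology.
Local Open Scope classical_set_scope.
Local Open Scope quotient_scope.

(* The closed points of the projective line over K, for K algebraically      *)
(* closed: [Some w] is the point of coordinate w in the chart V, [None] the  *)
(* point at infinity z = 0 of the chart U.                                   *)
Definition projline (K : fieldType) : Type := option K.

Section ProjectiveLine.
Variable K : fieldType.
Implicit Types (A B : set K) (W : set (projline K)).

HB.instance Definition _ := gen_eqMixin (projline K).
HB.instance Definition _ := gen_choiceMixin (projline K).

Definition ptV (w : K) : projline K := Some w.
Definition ptU (z : K) : projline K := if z == 0 then None else Some z^-1.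

Definition chartU : set (projline K) := range ptU.
Definition chartV : set (projline K) := range ptV.

Definition zariski_open A := forall p, A p ->
  exists2 f : {poly K}, f.[p] != 0 & forall x, f.[x] != 0 -> A x.

Lemma zariski_openT : zariski_open setT.
Proof. by move=> p _; exists 1 => //; rewrite hornerE oner_neq0. Qed.

Lemma zariski_openI A B :
  zariski_open A -> zariski_open B -> zariski_open (A `&` B).
Proof.
move=> oA oB p [/oA[f fp fA] /oB[g gp gB]].
exists (f * g) => [|x]; first by rewrite hornerM mulf_neq0.
by rewrite hornerM mulf_eq0 negb_or => /andP[/fA ? /gB].
Qed.

Lemma zariski_open_bigcup (I : Type) (f : I -> set K) :
  (forall i, zariski_open (f i)) -> zariski_open (\bigcup_i f i).
Proof.
move=> of_ p [i _ /(of_ i)[g gp gf]]; exists g => // x /gf fx.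
by exists i.
Qed.

Definition projline_open W :=
  zariski_open (ptU @^-1` W) /\ zariski_open (ptV @^-1` W).

Lemma projline_openT : projline_open setT.
Proof. by split; rewrite preimage_setT; exact: zariski_openT. Qed.

Lemma projline_openI : setI_closed projline_open.
Proof.
move=> A B [uA vA] [uB vB].
by split; rewrite preimage_setI; apply: zariski_openI.
Qed.

Lemma projline_open_bigcup (I : Type) (f : I -> set (projline K)) :
  (forall i, projline_open (f i)) -> projline_open (\bigcup_i f i).
Proof.
by move=> of_; split; rewrite preimage_bigcup; apply: zariski_open_bigcup => i;
  case: (of_ i).
Qed.

HB.instance Definition _ := isOpenTopological.Build (projline K)
  projline_openT projline_openI projline_open_bigcup.

Lemma chartU_open : open chartU.
Proof.
split=> p /=.
  by move=> _; exists 1 => [|x _]; [rewrite hornerE oner_neq0|exists x].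
move=> [z _ zp]; exists 'X => [|x]; rewrite hornerX.
  by move: zp; rewrite /ptU /ptV; case: eqP => // /eqP z0 [<-]; rewrite invr_eq0.
move=> x0; exists x^-1 => //.
by rewrite /ptU invr_eq0 (negPf x0) invrK.
Qed.

Lemma chartV_open : open chartV.
Proof.
split=> p /=; last first.
  by move=> _; exists 1 => [|x _]; [rewrite hornerE oner_neq0|exists x].
move=> [w _]; rewrite /ptU /ptV; case: eqP => // /eqP p0 _.
exists 'X => [|x]; rewrite hornerX // => x0.
by exists x^-1 => //; rewrite (negPf x0).
Qed.

Lemma chartUV_cover : chartU `|` chartV = setT.
Proof.
apply/seteqP; split=> // -[w|] _; first by right; exists w.
by left; exists 0 => //; rewrite /ptU eqxx.
Qed.

Definition regular_fun A (f : K -> K) := forall p, A p ->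
  exists2 ab : {poly K} * {poly K}, ab.2.[p] != 0 &
    forall x, A x -> ab.2.[x] != 0 -> f x = ab.1.[x] / ab.2.[x].

Lemma regular_cst A c : regular_fun A (fun=> c).
Proof.
move=> p _; exists (c%:P, 1) => /=; first by rewrite hornerE oner_neq0.
by move=> x _ _; rewrite !hornerE divr1.
Qed.

Lemma regularD A f g : regular_fun A f -> regular_fun A g ->
  regular_fun A (fun x => f x + g x).
Proof.
move=> rf rg p Ap; have [[a b] /= bp fE] := rf p Ap.
have [[c d] /= dp gE] := rg p Ap.
exists (a * d + c * b, b * d) => /=; first by rewrite hornerM mulf_neq0.
move=> x Ax; rewrite hornerM mulf_eq0 negb_or => /andP[bx dx].
by rewrite fE // gE // ?hornerD !hornerM; field; rewrite bx dx.
Qed.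

Lemma regularM A f g : regular_fun A f -> regular_fun A g ->
  regular_fun A (fun x => f x * g x).
Proof.
move=> rf rg p Ap; have [[a b] /= bp fE] := rf p Ap.
have [[c d] /= dp gE] := rg p Ap.
exists (a * c, b * d) => /=; first by rewrite hornerM mulf_neq0.
move=> x Ax; rewrite hornerM mulf_eq0 negb_or => /andP[bx dx].
by rewrite fE // gE // ?hornerD !hornerM; field; rewrite bx dx.
Qed.

Lemma regular_sum A (I : Type) (r : seq I) (P : pred I) (f : I -> K -> K) :
  (forall i, P i -> regular_fun A (f i)) ->
  regular_fun A (fun x => \sum_(i <- r | P i) f i x).
Proof.
move=> rf; elim: r => [|i r IHr].
  have -> : (fun x => \sum_(i <- [::] | P i) f i x) = fun=> 0.
    by apply/funext => x; rewrite big_nil.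
  exact: regular_cst.
have -> : (fun x => \sum_(j <- i :: r | P j) f j x) =
  fun x => (if P i then f i x else 0) + \sum_(j <- r | P j) f j x.
  by apply/funext => x; rewrite big_cons; case: ifP => //; rewrite add0r.
apply: regularD => //; case: (boolP (P i)) => [/rf//|_].
exact: regular_cst.
Qed.

Lemma regularS A B f : A `<=` B -> regular_fun B f -> regular_fun A f.
Proof.
move=> sAB rf p /sAB /rf[ab bp fE]; exists ab => // x /sAB Bx.
exact: fE.
Qed.

End ProjectiveLine.

Section ProjectiveSuperspace.
Variables (K : fieldType) (m : nat).
Implicit Types (W : set (projline K)).

(* The expressions [s.1] (resp. [s.2]) of a function on P^{1|m} in the       *)
(* coordinates (z|theta) of U (resp. (w|psi) of V). Only the values at the   *)
(* points of the domain are meaningful, see [eq_on].                         *)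
Definition expr : Type := (K -> ext K m) * (K -> ext K m).

Implicit Types (s t u : expr).

Definition expr_one : expr := (fun=> 1, fun=> 1).
Definition expr_mul s t : expr :=
  (fun z => s.1 z * t.1 z, fun w => s.2 w * t.2 w).

Local Notation "s ** t" := (expr_mul s t) (at level 40, left associativity).

Lemma expr_mulA : associative expr_mul.
Proof.
by move=> s t u; congr (_, _); apply/funext => x /=; exact: (@mulrA (ext K m)).
Qed.

Lemma expr_mul1 : left_id expr_one expr_mul.
Proof.
by case=> f g; congr (_, _); apply/funext => x /=; exact: (@mul1r (ext K m)).
Qed.

Lemma expr_mulr1 : right_id expr_one expr_mul.
Proof.
by case=> f g; congr (_, _); apply/funext => x /=; exact: (@mulr1 (ext K m)).
Qed.

Definition eq_on W s t :=
  (forall z, W (ptU z) -> s.1 z = t.1 z) /\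
  (forall w, W (ptV w) -> s.2 w = t.2 w).

(* The sections over W of the structure sheaf: each chart is an A^{1|m},     *)
(* whose structure sheaf is the exterior algebra over the regular functions; *)
(* the gluing is z = 1/w, theta_i = psi_i/w.                                 *)
Definition is_section W s := [/\
  forall S, regular_fun (@ptU K @^-1` W) (fun z => s.1 z S),
  forall S, regular_fun (@ptV K @^-1` W) (fun w => s.2 w S) &
  forall w, w != 0 -> W (ptV w) -> s.2 w = ext_rescale w (s.1 w^-1)].

Definition even_on W s :=
  (forall z, W (ptU z) -> ext_even (s.1 z)) /\
  (forall w, W (ptV w) -> ext_even (s.2 w)).

Definition even_section W s := is_section W s /\ even_on W s.

(* The sections over W of the sheaf O^*_0 of even invertible sections.       *)
Definition even_unit W s :=
  even_section W s /\ exists2 t, even_section W t & eq_on W (s ** t) expr_one.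

Lemma eq_on_refl W s : eq_on W s s. Proof. by []. Qed.

Lemma eq_on_sym W s t : eq_on W s t -> eq_on W t s.
Proof. by move=> [sU sV]; split=> x Wx; [rewrite sU|rewrite sV]. Qed.

Lemma eq_on_trans W s t u : eq_on W s t -> eq_on W t u -> eq_on W s u.
Proof.
by move=> [sU sV] [tU tV]; split=> x Wx; [rewrite sU ?tU|rewrite sV ?tV].
Qed.

Lemma eq_onM W s s' t t' :
  eq_on W s s' -> eq_on W t t' -> eq_on W (s ** t) (s' ** t').
Proof.
by move=> [sU sV] [tU tV]; split=> x Wx /=; [rewrite sU ?tU|rewrite sV ?tV].
Qed.

Lemma eq_onS W W' s t : W `<=` W' -> eq_on W' s t -> eq_on W s t.
Proof. by move=> sW [sU sV]; split=> x /sW; [exact: sU|exact: sV]. Qed.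

Lemma eq_onC W s t : even_on W s -> eq_on W (s ** t) (t ** s).
Proof.
by move=> [eU eV]; split=> x Wx /=; rewrite (@ext_evenC _ _ (_ x)); auto.
Qed.

Lemma even_section1 W : even_section W expr_one.
Proof.
split; last by split=> x _; exact: ext_even1.
split=> [S|S|w w0 _]; last by rewrite /= ext_rescale1.
- by under [X in regular_fun _ X]funext => x do rewrite ext1E; exact: regular_cst.
- by under [X in regular_fun _ X]funext => x do rewrite ext1E; exact: regular_cst.
Qed.

Lemma even_sectionM W s t :
  even_section W s -> even_section W t -> even_section W (s ** t).
Proof.
have rM A (f g : K -> ext K m) :
    (forall S, regular_fun A (fun x => f x S)) ->
    (forall S, regular_fun A (fun x => g x S)) ->
  forall S, regular_fun A (fun x => (f x * g x) S).
  move=> rf rg S; under [X in regular_fun _ X]funext => x do rewrite extME.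
  do 2!apply: regular_sum => ? _.
  by apply: regularM; [exact: regular_cst|exact: regularM].
move=> [[sU sV sc] [esU esV]] [[tU tV tc] [etU etV]].
split; last by split=> x Wx /=; apply: ext_evenM; auto.
split=> [||w w0 Ww]; [exact: rM|exact: rM|].
by rewrite /= ext_rescaleM -sc // -tc.
Qed.

Lemma even_sectionS W W' s : W `<=` W' -> even_section W' s -> even_section W s.
Proof.
move=> sW [[sU sV sc] [eU eV]]; split; last first.
  by split=> x /sW; [exact: eU|exact: eV].
split=> [S|S|w w0 /sW]; last exact: sc.
  by apply: regularS (sU S) => x; exact: sW.
by apply: regularS (sV S) => x; exact: sW.
Qed.

Lemma even_unit1 W : even_unit W expr_one.
Proof.
by split; [exact: even_section1|exists expr_one; [exact: even_section1|rewrite expr_mulr1]].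
Qed.

Lemma even_unitM W s t : even_unit W s -> even_unit W t -> even_unit W (s ** t).
Proof.
move=> [es [s' es' ss']] [et [t' et' tt']]; split; first exact: even_sectionM.
exists (t' ** s'); first exact: even_sectionM.
rewrite -expr_mulA (expr_mulA t); apply: eq_on_trans ss'.
apply: eq_onM => //; rewrite -[X in eq_on _ _ X]expr_mul1.
exact: eq_onM.
Qed.

Lemma even_unitS W W' s : W `<=` W' -> even_unit W' s -> even_unit W s.
Proof.
move=> sW [es [t et st]]; split; first exact: even_sectionS es.
by exists t; [exact: even_sectionS et|exact: eq_onS st].
Qed.

End ProjectiveSuperspace.

Arguments expr_one {K m}.

Section EvenPicardGroup.
Variables (K : fieldType) (m : nat).

Local Notation "s ** t" := (expr_mul s t) (at level 40, left associativity).

(* A 1-cocycle of O^*_0 on an open covering, i.e. the transition functions   *)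
(* of a locally-free sheaf of rank 1|0 trivialised over that covering. The   *)
(* coverings are indexed by the points of P^1, with x in opn x: these are     *)
(* cofinal among all open coverings, and they keep the type of cocycles in   *)
(* the universe of K.                                                        *)
Record cocycle := Cocycle {
  opn : projline K -> set (projline K);
  trf : projline K -> projline K -> expr K m;
  opn_open : forall x, open (opn x);
  opn_mem : forall x, opn x x;
  trf_unit : forall x y, even_unit (opn x `&` opn y) (trf x y);
  trf_cocycle : forall x y z,
    eq_on (opn x `&` opn y `&` opn z) (trf x y ** trf y z) (trf x z) }.

Implicit Types (c d e : cocycle).

(* Equality in the direct limit, over the open coverings of P^1, of the      *)
(* Cech groups H^1: the restrictions to some common refinement W differ by   *)
(* the coboundary of a 0-cochain h.                                          *)
Definition cohomologous c d : Prop :=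
  exists (W : projline K -> set (projline K)) (h : projline K -> expr K m),
  [/\ forall x, open (W x), forall x, W x x,
      forall x, W x `<=` opn c x `&` opn d x,
      forall x, even_unit (W x) (h x) &
      forall x y, eq_on (W x `&` W y)
        (h x ** trf d x y) (trf c x y ** h y)].

Lemma even_trf c x y W : W `<=` opn c x `&` opn c y -> even_on W (trf c x y).
Proof. by move=> sW; case: (even_unitS sW (trf_unit c x y)) => -[]. Qed.

Lemma trf_id c x : eq_on (opn c x) (trf c x x) expr_one.
Proof.
have [_ [t _ gt1]] := trf_unit c x x; rewrite setIid in gt1.
have := trf_cocycle c x x x; rewrite !setIid => gg.
have gtg : eq_on (opn c x) (trf c x x ** trf c x x ** t) expr_one.
  by apply: eq_on_trans gt1; apply: eq_onM.
apply: eq_on_trans gtg; rewrite -expr_mulA -[X in eq_on _ X _]expr_mulr1.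
by apply: eq_onM => //; apply: eq_on_sym.
Qed.

Lemma eq_cohomologous c d :
  (forall x y, eq_on (opn c x `&` opn d x `&` (opn c y `&` opn d y))
     (trf d x y) (trf c x y)) ->
  cohomologous c d.
Proof.
move=> cd; exists (fun x => opn c x `&` opn d x), (fun=> expr_one); split.
- by move=> x; apply: openI; exact: opn_open.
- by move=> x; split; exact: opn_mem.
- by move=> x z.
- by move=> x; exact: even_unit1.
- by move=> x y; rewrite expr_mul1 expr_mulr1.
Qed.

Lemma cohomologous_refl c : cohomologous c c.
Proof. exact: eq_cohomologous. Qed.

Lemma cohomologous_sym c d : cohomologous c d -> cohomologous d c.
Proof.
move=> [W [h [oW mW sW uh gh]]].
have hv x : exists t, even_section (W x) t /\ eq_on (W x) (h x ** t) expr_one.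
  by have [_ [t]] := uh x; exists t.
have [t ht] := choice hv.
have eh x : even_on (W x) (h x) by case: (uh x) => -[].
have th x : eq_on (W x) (t x ** h x) expr_one.
  by apply: eq_on_trans (ht x).2; apply: eq_onC; case: (ht x) => -[].
exists W, t; split=> // [x z /sW[]//|x|x y].
  by split; [exact: (ht x).1|exists (h x) => //; case: (uh x)].
have sl : W x `&` W y `<=` W x by move=> z [].
have sr : W x `&` W y `<=` W y by move=> z [].
apply: (@eq_on_trans _ _ _ _ (t x ** (trf c x y ** h y) ** t y)).
  rewrite -!expr_mulA; apply: eq_onM => //.
  rewrite -[X in eq_on _ X _]expr_mulr1.
  by apply: eq_onM => //; apply/eq_on_sym/(eq_onS sr); case: (ht y).
apply: (@eq_on_trans _ _ _ _ (t x ** (h x ** trf d x y) ** t y)).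
  by apply: eq_onM => //; apply: eq_onM => //; apply: eq_on_sym.
apply: eq_onM => //; rewrite expr_mulA -[X in eq_on _ _ X]expr_mul1.
by apply: eq_onM => //; exact: (eq_onS sl).
Qed.

Lemma cohomologous_trans c d e :
  cohomologous c d -> cohomologous d e -> cohomologous c e.
Proof.
move=> [W [h [oW mW sW uh gh]]] [W' [h' [oW' mW' sW' uh' gh']]].
exists (fun x => W x `&` W' x), (fun x => h x ** h' x); split.
- by move=> x; apply: openI.
- by [].
- by move=> x z [/sW[? _] /sW'[]].
- move=> x; apply: even_unitM.
  + by apply: even_unitS (uh _) => z [].
  + by apply: even_unitS (uh' _) => z [].
move=> x y; set D := (X in eq_on X).
have D1 : D `<=` W x `&` W y by move=> z [[? ?] [? ?]].
have D2 : D `<=` W' x `&` W' y by move=> z [[? ?] [? ?]].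
apply: (@eq_on_trans _ _ _ _ (h x ** (trf d x y ** h' y))).
  by rewrite -expr_mulA; apply: eq_onM => //; exact: (eq_onS D2).
rewrite !expr_mulA; apply: eq_onM => //.
exact: (eq_onS D1).
Qed.

Definition cohomologousb c d : bool := `[< cohomologous c d >].

Lemma cohomologousb_refl : reflexive cohomologousb.
Proof. by move=> c; apply/asboolP/cohomologous_refl. Qed.

Lemma cohomologousb_sym : symmetric cohomologousb.
Proof. by move=> c d; apply/asbool_equiv_eq; split=> /cohomologous_sym. Qed.

Lemma cohomologousb_trans : transitive cohomologousb.
Proof.
by move=> d c e /asboolP cd /asboolP de; apply/asboolP/(cohomologous_trans cd).
Qed.

HB.instance Definition _ := gen_eqMixin cocycle.
HB.instance Definition _ := gen_choiceMixin cocycle.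

Canonical cohomologous_equiv := EquivRel cohomologousb
  cohomologousb_refl cohomologousb_sym cohomologousb_trans.

(* H^1(O^*_{P^{1|m},0}); its group law, induced by the product of cocycles,  *)
(* is the tensor product of invertible sheaves.                              *)
Definition Pic0 : Type := {eq_quot cohomologous_equiv}.
HB.instance Definition _ := Choice.copy Pic0 {eq_quot cohomologous_equiv}.

Definition class_of (c : cocycle) : Pic0 := \pi_{eq_quot cohomologous_equiv} c.

Lemma class_ofP c d : class_of c = class_of d <-> cohomologous c d.
Proof.
split; first by move/eqmodP/asboolP.
by move=> cd; apply/eqmodP/asboolP.
Qed.

Lemma class_of_surj (x : Pic0) : exists c, x = class_of c.
Proof. by exists (repr (x : {eq_quot _})); rewrite /class_of reprK. Qed.

Lemma cocycle_oneP W : eq_on W (expr_one ** expr_one : expr K m) expr_one.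
Proof. by rewrite expr_mul1. Qed.

Definition cocycle_one : cocycle := @Cocycle (fun=> setT)
  (fun _ _ => expr_one) (fun=> openT) (fun=> I)
  (fun _ _ => even_unit1 _ _) (fun _ _ _ => cocycle_oneP _).

Section Mul.
Variables c d : cocycle.
Let mul_opn x := opn c x `&` opn d x.
Let mul_trf x y := trf c x y ** trf d x y.

Lemma cocycle_mul_open x : open (mul_opn x).
Proof. by apply: openI; exact: opn_open. Qed.

Lemma cocycle_mul_mem x : mul_opn x x.
Proof. by split; exact: opn_mem. Qed.

Lemma cocycle_mul_unit x y : even_unit (mul_opn x `&` mul_opn y) (mul_trf x y).
Proof.
apply: even_unitM.
- by apply: even_unitS (trf_unit _ _ _) => z [[? ?] [? ?]].
- by apply: even_unitS (trf_unit _ _ _) => z [[? ?] [? ?]].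
Qed.

Lemma cocycle_mulP x y z :
  eq_on (mul_opn x `&` mul_opn y `&` mul_opn z)
    (mul_trf x y ** mul_trf y z) (mul_trf x z).
Proof.
set D := (X in eq_on X).
apply: (@eq_on_trans _ _ _ _
  (trf c x y ** trf c y z ** (trf d x y ** trf d y z))).
  rewrite /mul_trf !expr_mulA; apply: eq_onM => //.
  rewrite -!expr_mulA; apply: eq_onM => //.
  apply/eq_on_sym/eq_onC/even_trf.
  by move=> t [[[? ?] [? ?]] [? ?]].
apply: eq_onM.
- by apply: eq_onS (trf_cocycle _ _ _ _) => t [[[? ?] [? ?]] [? ?]].
- by apply: eq_onS (trf_cocycle _ _ _ _) => t [[[? ?] [? ?]] [? ?]].
Qed.

(* The cocycle of the tensor product. *)
Definition cocycle_mul : cocycle := @Cocycle mul_opn mul_trf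
  cocycle_mul_open cocycle_mul_mem cocycle_mul_unit cocycle_mulP.

End Mul.

Lemma cocycle_inv_unit c x y : even_unit (opn c x `&` opn c y) (trf c y x).
Proof. by rewrite setIC; exact: trf_unit. Qed.

Lemma cocycle_invP c x y z :
  eq_on (opn c x `&` opn c y `&` opn c z) (trf c y x ** trf c z y) (trf c z x).
Proof.
apply: (@eq_on_trans _ _ _ _ (trf c z y ** trf c y x)).
  by apply/eq_onC/even_trf => t [[? ?] ?].
by apply: eq_onS (trf_cocycle _ _ _ _) => t [[? ?] ?].
Qed.

(* The cocycle of the dual: by the cocycle condition, g_yx inverts g_xy. *)
Definition cocycle_inv c : cocycle := @Cocycle (opn c)
  (fun x y => trf c y x) (opn_open c) (opn_mem c)
  (cocycle_inv_unit c) (cocycle_invP c).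

Lemma cohomologous_mul c c' d d' : cohomologous c c' -> cohomologous d d' ->
  cohomologous (cocycle_mul c d) (cocycle_mul c' d').
Proof.
move=> [W [h [oW mW sW uh gh]]] [W' [h' [oW' mW' sW' uh' gh']]].
exists (fun x => W x `&` W' x), (fun x => h x ** h' x); split.
- by move=> x; apply: openI.
- by [].
- by move=> x z [/sW[? ?] /sW'[? ?]].
- move=> x; apply: even_unitM.
  + by apply: even_unitS (uh _) => z [].
  + by apply: even_unitS (uh' _) => z [].
move=> x y /=; set D := (X in eq_on X).
have D1 : D `<=` W x `&` W y by move=> z [[? ?] [? ?]].
have D2 : D `<=` W' x `&` W' y by move=> z [[? ?] [? ?]].
have ev (s t u v : expr K m) : even_on D t ->
    eq_on D (s ** t ** (u ** v)) (s ** u ** (t ** v)).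
  move=> et; rewrite -!expr_mulA; apply: eq_onM => //; rewrite !expr_mulA.
  by apply: eq_onM => //; exact: eq_onC.
apply: (eq_on_trans (ev _ _ _ _ _)).
  by have /(even_unitS (fun z Dz => (D2 z Dz).1)) [[]] := uh' x.
apply: eq_on_sym; apply: (eq_on_trans (ev _ _ _ _ _)).
  by apply: even_trf => z /D2[/sW'[? _] /sW'[? _]].
by apply: eq_onM; apply: eq_on_sym; [exact: (eq_onS D1)|exact: (eq_onS D2)].
Qed.

Lemma cohomologous_inv c d :
  cohomologous c d -> cohomologous (cocycle_inv c) (cocycle_inv d).
Proof.
move=> /cohomologous_sym [W [h [oW mW sW uh gh]]].
exists W, h; split=> //= [x z /sW[]//|x y].
have := gh y x; rewrite setIC; set D := (X in eq_on X) => ghyx.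
have ehx : even_on D (h x).
  by have /(even_unitS (fun z (Dz : D z) => Dz.1)) [[]] := uh x.
have ehy : even_on D (h y).
  by have /(even_unitS (fun z (Dz : D z) => Dz.2)) [[]] := uh y.
apply: (eq_on_trans (eq_onC _ ehx)); apply: eq_on_trans (eq_onC _ ehy).
exact: eq_on_sym.
Qed.

Definition Pic0_one : Pic0 := class_of cocycle_one.
Definition Pic0_mul (x y : Pic0) : Pic0 :=
  class_of (cocycle_mul (repr (x : {eq_quot _})) (repr (y : {eq_quot _}))).
Definition Pic0_inv (x : Pic0) : Pic0 :=
  class_of (cocycle_inv (repr (x : {eq_quot _}))).

Lemma repr_class c : cohomologous (repr (class_of c : {eq_quot _})) c.
Proof. by apply/class_ofP; rewrite /class_of reprK. Qed.

Lemma class_of_mul c d :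
  class_of (cocycle_mul c d) = Pic0_mul (class_of c) (class_of d).
Proof.
by apply/esym/class_ofP/cohomologous_mul; exact: repr_class.
Qed.

Lemma class_of_inv c : class_of (cocycle_inv c) = Pic0_inv (class_of c).
Proof. by apply/esym/class_ofP/cohomologous_inv; exact: repr_class. Qed.

Lemma Pic0_mulA : associative Pic0_mul.
Proof.
move=> p q r; have [c ->] := class_of_surj p; have [d ->] := class_of_surj q.
have [e ->] := class_of_surj r; rewrite -!class_of_mul; apply/class_ofP.
by apply: eq_cohomologous => x y /=; rewrite expr_mulA.
Qed.

Lemma Pic0_mulC : commutative Pic0_mul.
Proof.
move=> p q; have [c ->] := class_of_surj p; have [d ->] := class_of_surj q.
rewrite -!class_of_mul; apply/class_ofP.
apply: eq_cohomologous => x y /=; apply/eq_onC/even_trf.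
by move=> z [[[? ?] _] [[? ?] _]].
Qed.

Lemma Pic0_mul1 : left_id Pic0_one Pic0_mul.
Proof.
move=> p; have [c ->] := class_of_surj p; rewrite -class_of_mul; apply/class_ofP.
by apply: eq_cohomologous => x y /=; rewrite expr_mul1.
Qed.

Lemma Pic0_mulV : left_inverse Pic0_one Pic0_inv Pic0_mul.
Proof.
move=> p; have [c ->] := class_of_surj p.
rewrite -class_of_inv -class_of_mul; apply/class_ofP.
apply: eq_cohomologous => x y /=; apply: eq_on_sym; set D := (X in eq_on X).
have D1 : D `<=` opn c y by move=> z [_ [[? ?] _]].
apply: eq_on_trans (eq_onS D1 (trf_id c y)).
apply: eq_onS (trf_cocycle c y x y).
by move=> z [[[? ?] _] [[? ?] _]].
Qed.

Lemma Pic0_mul1r : right_id Pic0_one Pic0_mul.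
Proof. by move=> x; rewrite Pic0_mulC Pic0_mul1. Qed.

Lemma Pic0_mulVr : right_inverse Pic0_one Pic0_inv Pic0_mul.
Proof. by move=> x; rewrite Pic0_mulC Pic0_mulV. Qed.

HB.instance Definition _ := isGroup.Build Pic0
  Pic0_mulA Pic0_mul1 Pic0_mul1r Pic0_mulV Pic0_mulVr.

End EvenPicardGroup.

Section TransitionFunctions.
Variables (K : fieldType) (m : nat).
Implicit Types (f : K -> ext K m).

Local Notation "s ** t" := (expr_mul s t) (at level 40, left associativity).

Definition overlap : set (projline K) := @chartU K `&` @chartV K.

Section Gluing.
Variables (g : expr K m) (hg : even_unit overlap g).

Definition even_unit_inv : expr K m := s2val (cid2 hg.2).

Lemma even_unit_invP :
  even_unit overlap even_unit_inv /\ eq_on overlap (g ** even_unit_inv) expr_one.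
Proof.
rewrite /even_unit_inv; case: cid2 => t et gt /=.
have gs : even_section overlap g := hg.1.
split=> //; split=> //; exists g => //.
by apply: eq_on_trans gt; apply: eq_onC; case: et.
Qed.

Definition glue_opn (x : projline K) : set (projline K) :=
  if x is Some _ then @chartV K else @chartU K.

Definition glue_trf (x y : projline K) : expr K m :=
  match x, y with
  | None, Some _ => g
  | Some _, None => even_unit_inv
  | _, _ => expr_one
  end.

Lemma glue_open x : open (glue_opn x).
Proof. by case: x => [w|]; [exact: chartV_open|exact: chartU_open]. Qed.

Lemma glue_mem x : glue_opn x x.
Proof.
by case: x => [w|]; [exists w|exists 0 => //; rewrite /ptU eqxx].
Qed.

Lemma glue_unit x y : even_unit (glue_opn x `&` glue_opn y) (glue_trf x y).
Proof.
case: x y => [w|] [w'|] /=; try exact: even_unit1; last exact: hg.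
by rewrite setIC; exact: even_unit_invP.1.
Qed.

Lemma glueP x y z : eq_on (glue_opn x `&` glue_opn y `&` glue_opn z)
  (glue_trf x y ** glue_trf y z) (glue_trf x z).
Proof.
have [_ gv] := even_unit_invP.
have vg : eq_on overlap (even_unit_inv ** g) expr_one.
  by apply: eq_on_trans gv; apply: eq_onC; case: even_unit_invP => -[[]].
case: x y z => [?|] [?|] [?|] /=; rewrite ?expr_mul1 ?expr_mulr1 //.
- by apply: eq_onS vg => t [[? ?] ?].
- by apply: eq_onS gv => t [[? ?] ?].
Qed.

(* The sheaf glued from the trivial ones on U and V by the transition        *)
(* function g on the overlap: U is the neighbourhood assigned to the point   *)
(* at infinity, V the one assigned to all other points.                      *)
Definition glue : cocycle K m := @Cocycle K m glue_opn glue_trf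
  glue_open glue_mem glue_unit glueP.

End Gluing.

(* The function of expression f in the coordinates (w|psi), expanded in      *)
(* (z|theta) by w = 1/z and psi_i = theta_i/z.                               *)
Definition of_chartV f : expr K m := (fun z => ext_rescale z (f z^-1), f).

Lemma overlap_ptU z : overlap (ptU z) <-> z != 0.
Proof.
split=> [[_ [w _]]|z0]; first by rewrite /ptV /ptU; case: eqP.
by split; [exists z|exists z^-1 => //; rewrite /ptU (negPf z0)].
Qed.

Lemma overlap_ptV w : overlap (ptV w) <-> w != 0.
Proof.
split=> [[[z _]]|w0].
  by rewrite /ptV /ptU; case: eqP => // /eqP z0 [<-]; rewrite invr_eq0.
split; last by exists w.
by exists w^-1 => //; rewrite /ptU invr_eq0 (negPf w0) invrK.
Qed.

Definition ext_regular f := forall S, regular_fun [set x | x != 0] (f^~ S).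

Lemma regular_id A : regular_fun A (@id K).
Proof.
move=> p _; exists ('X, 1) => /=; first by rewrite hornerE oner_neq0.
by move=> x _ _; rewrite hornerX hornerC divr1.
Qed.

Lemma regular_inv : regular_fun [set x : K | x != 0] (fun x => x^-1).
Proof.
move=> p /= p0; exists (1, 'X) => /=; first by rewrite hornerX.
by move=> x _ _; rewrite hornerX hornerC div1r.
Qed.

Lemma regularX A (f : K -> K) n :
  regular_fun A f -> regular_fun A (fun x => f x ^+ n).
Proof.
move=> rf; elim: n => [|n IHn].
  by under [X in regular_fun _ X]funext => x do rewrite expr0; exact: regular_cst.
by under [X in regular_fun _ X]funext => x do rewrite exprS; exact: regularM.
Qed.

Lemma ext_regularM f g :
  ext_regular f -> ext_regular g -> ext_regular (fun x => f x * g x).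
Proof.
move=> rf rg S; under [X in regular_fun _ X]funext => x do rewrite extME.
do 2!apply: regular_sum => ? _.
by apply: regularM; [exact: regular_cst|exact: regularM].
Qed.

Lemma ext_regularD f g :
  ext_regular f -> ext_regular g -> ext_regular (fun x => f x + g x).
Proof.
move=> rf rg S; under [X in regular_fun _ X]funext => x do rewrite extDE.
exact: regularD.
Qed.

Lemma ext_regular_cst a : ext_regular (fun=> a).
Proof. by move=> S; exact: regular_cst. Qed.

Lemma ext_regularZ (f : K -> K) a : regular_fun [set x | x != 0] f ->
  ext_regular (fun x => f x *: a).
Proof.
move=> rf S; under [X in regular_fun _ X]funext => x do rewrite extZE.
by apply: regularM => //; exact: regular_cst.
Qed.

Lemma ext_regular_sum (I : Type) (r : seq I) (P : pred I)
    (f : I -> K -> ext K m) :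
  (forall i, P i -> ext_regular (f i)) ->
  ext_regular (fun x => \sum_(i <- r | P i) f i x).
Proof.
move=> rf S.
have -> : (fun x => (\sum_(i <- r | P i) f i x) S) =
          fun x => \sum_(i <- r | P i) f i x S.
  by apply/funext => x; rewrite ext_sumE.
by apply: regular_sum => i Pi; exact: rf.
Qed.

Lemma ext_regularX f n : ext_regular f -> ext_regular (fun x => f x ^+ n).
Proof.
move=> rf; elim: n => [|n IHn]; first exact: ext_regular_cst.
by under [X in ext_regular X]funext => x do rewrite exprS; exact: ext_regularM.
Qed.

Lemma of_chartV_section f : ext_regular f -> ext_regular (fun x => f x^-1) ->
  (forall w, ext_even (f w)) -> even_section overlap (of_chartV f).
Proof.
move=> rf rfV ef; split; last first.
  split=> x _ //= S oS; rewrite ffunE ef ?mulr0 //.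
have sU : @ptU K @^-1` overlap `<=` [set x : K | x != 0].
  by move=> x /overlap_ptU.
have sV : @ptV K @^-1` overlap `<=` [set x : K | x != 0].
  by move=> x /overlap_ptV.
split=> [S|S|w w0 _ /=].
- apply: (regularS sU) => /=.
  under [X in regular_fun _ X]funext => x do rewrite ffunE -exprVn.
  apply: regularM; last exact: rfV.
  exact: regularX regular_inv.
- by apply: (regularS sV); exact: rf.
- apply/ffunP => S; rewrite !ffunE invrK mulrA exprVn invrK mulVf ?mul1r //.
  by rewrite expf_neq0.
Qed.

Lemma of_chartV_unit f g :
  ext_regular f -> ext_regular (fun x => f x^-1) -> (forall w, ext_even (f w)) ->
  ext_regular g -> ext_regular (fun x => g x^-1) -> (forall w, ext_even (g w)) ->
  (forall w, w != 0 -> f w * g w = 1) -> even_unit overlap (of_chartV f).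
Proof.
move=> rf rfV ef rg rgV eg fg; split; first exact: of_chartV_section.
exists (of_chartV g); first exact: of_chartV_section.
split=> x /=; last by move/overlap_ptV/fg.
by move=> /overlap_ptU x0; rewrite -ext_rescaleM fg ?ext_rescale1 ?invr_eq0.
Qed.

Definition w_power (k : int) : expr K m := of_chartV (fun w => (w ^ k)%:A).

Lemma w_power_unit k : even_unit overlap (w_power k).
Proof.
have reg l : ext_regular (fun w : K => (w ^ l)%:A).
  apply: ext_regularZ; case: l => n; first by apply: regularX; exact: regular_id.
  under [X in regular_fun _ X]funext => x do rewrite NegzE -exprnN -exprVn.
  exact: regularX regular_inv.
have regV l : ext_regular (fun w : K => (w^-1 ^ l)%:A).
  by under [X in ext_regular X]funext => x do rewrite exprz_inv; exact: reg.
have ev l (w : K) : ext_even ((w ^ l)%:A : ext K m).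
  by move=> S oS; rewrite extZE ext_even1 // mulr0.
apply: (@of_chartV_unit _ (fun w => (w ^ (- k))%:A)) => // w w0.
by rewrite -scalerAl mul1r scalerA -expfzDr // subrr expr0z scale1r.
Qed.

Definition nilpotent_part (c : {set 'I_m} -> nat -> K) (w : K) : ext K m :=
  \sum_(1 <= j < m./2.+1) \sum_(S : {set 'I_m} | #|S| == j.*2)
    \sum_(1 <= l < j.*2) (c S l / w ^+ l) *: ext_monomial S.

Definition unipotent c : expr K m := of_chartV (fun w => 1 + nilpotent_part c w).

Lemma nilpotent_part_regular c : ext_regular (nilpotent_part c).
Proof.
do 3!apply: ext_regular_sum => ? _; apply: ext_regularZ.
apply: regularM; first exact: regular_cst.
under [X in regular_fun _ X]funext => x do rewrite -exprVn.
exact: regularX regular_inv.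
Qed.

Lemma nilpotent_part_regularV c : ext_regular (fun x => nilpotent_part c x^-1).
Proof.
do 3!apply: ext_regular_sum => ? _; apply: ext_regularZ.
apply: regularM; first exact: regular_cst.
under [X in regular_fun _ X]funext => x do rewrite -exprVn invrK.
by apply: regularX; exact: regular_id.
Qed.

Lemma nilpotent_part_even c w : ext_even (nilpotent_part c w).
Proof.
apply: ext_even_sum => j _; apply: ext_even_sum => S /eqP Sj.
apply: ext_even_sum => l _; apply: ext_evenZ => T oT.
rewrite ext_monomial_homogeneous // Sj; apply: contraTneq oT => ->.
by rewrite odd_double.
Qed.

Lemma nilpotent_partX c w : nilpotent_part c w ^+ m.+1 = 0.
Proof.
apply: ext_nilpotent => T; rewrite ltnS leqn0 => /eqP T0.
rewrite /nilpotent_part ext_sumE big_nat_cond big1 // => j /andP[/andP[j0 _] _].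
rewrite ext_sumE big1 // => S /eqP Sj; rewrite ext_sumE big1 // => l _.
by rewrite extZE ext_monomial_homogeneous ?mulr0 // T0 Sj; lia.
Qed.

Lemma unipotent_unit c : even_unit overlap (unipotent c).
Proof.
pose inv n : ext K m := \sum_(i < m.+1) (-1 *: n) ^+ i.
have regN f : ext_regular f -> ext_regular (fun x => -1 *: f x).
  move=> rf S; under [X in regular_fun _ X]funext => x do rewrite extZE.
  by apply: regularM => //; exact: regular_cst.
have reg1 f : ext_regular f -> ext_regular (fun x => 1 + f x).
  by move=> rf; apply: ext_regularD => //; exact: ext_regular_cst.
have regV f : ext_regular f -> ext_regular (fun x => inv (f x)).
  move=> rf; apply: ext_regular_sum => i _.
  by apply: ext_regularX; exact: regN.
apply: (@of_chartV_unit _ (fun w => inv (nilpotent_part c w))).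
- by apply: reg1; exact: nilpotent_part_regular.
- by apply: reg1; exact: nilpotent_part_regularV.
- by move=> w; apply: ext_evenD; [exact: ext_even1|exact: nilpotent_part_even].
- by apply: regV; exact: nilpotent_part_regular.
- by apply: regV; exact: nilpotent_part_regularV.
- move=> w; apply: ext_even_sum => i _; apply/ext_evenX/ext_evenZ.
  exact: nilpotent_part_even.
move=> w _; rewrite /inv scaleN1r; set n := nilpotent_part c w.
have := subrX1 (- n) m.+1; rewrite exprNn nilpotent_partX mulr0 sub0r.
by rewrite -opprD mulNr addrC => /oppr_inj.
Qed.

End TransitionFunctions.

Definition generated_subgroup (G : groupType) (A : set G) : set G :=
  smallest [set H : set G | group_closed [in H]] A.

(* Main.v *)
Require Import Defs.
From mathcomp Require Import all_boot all_order all_algebra complex ring zify.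
From mathcomp Require Import boolp classical_sets reals topology.

Set Implicit Arguments.
Unset Strict Implicit.
Unset Printing Implicit Defensive.

Import Order.TTheory GRing.Theory Num.Theory.
Local Open Scope ring_scope.
Local Open Scope complex_scope.
Local Open Scope classical_set_scope.

(** A sheaf of rank 1|0 is studied through its frames. The trivialization of a
    cocycle at one point is a frame over a nonempty open set, hence away from
    finitely many points, and these are removed one at a time. Near a point p of
    coordinate x = p, a frame defined on a punctured neighbourhood is an even
    invertible function f, and [local_factor] writes it as
    (x - p)^k (1 + n) u with n nilpotent and Laurent at p and u invertible near p.
    The factor (x - p)^k (1 + n) is invertible on the whole chart except at p, so
    dividing the frame by it makes it extend over p and harms no other point
    ([trivial_off_cons]). This replaces the vanishing theorems of cohomology: all
    that is needed is that Laurent functions approximate rational functions at p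
    to any order, which is a Bezout identity ([regular_laurent_approx]).

    After finitely many steps the sheaf has a frame over the chart V. The same
    factorization at infinity, in the coordinate z of the chart U, shows that the
    sheaf is glued from the two charts by a transition function w^k (1 + n) with n
    nilpotent and Laurent at 0 ([class_of_glue_laurent]).

    It remains to generate the class of 1 + n, by descending induction on the
    lowest degree d of n in the odd variables ([unipotent_laurent_generated]). The
    part of degree d of n splits into monomials regular on V, monomials regular on
    U, and the w^-l psi^S with 0 < l < d = |S|, because psi_i = w theta_i turns
    w^-l psi^S into z^(l - d) theta^S. The first two kinds are absorbed by changes
    of frame over V and U, the third is a generator, and what is left has order
    at least d + 1. *)

(** * Calculus in the exterior algebra *)

Section ExteriorCalculus.
Variables (K : fieldType) (m : nat).
Implicit Types (a b : ext K m) (S T : {set 'I_m}).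

Lemma extNE a S : (- a) S = - a S.
Proof. by rewrite [LHS]ffunE. Qed.

(** The coefficient at the empty set is the body, that is, the value modulo the
    odd generators. *)
Lemma ext_mul_body a b : (a * b) finset.set0 = a finset.set0 * b finset.set0.
Proof.
rewrite extME (bigD1 finset.set0) //= [X in _ + X]big1 => [|A nA].
  rewrite addr0 (eq_bigl (pred1 finset.set0)) => [|B]; last by rewrite finset.set0U.
  rewrite big_pred1_eq /shuffle_sign -finset.setI_eq0 finset.setI0 eqxx.
  by rewrite /inversions big_set0 mul1r.
by rewrite big1 // => B; rewrite finset.setU_eq0 (negPf nA).
Qed.

Lemma ext_order_geW d d' a : (d' <= d)%N -> ext_order_ge d a -> ext_order_ge d' a.
Proof. by move=> dd' ga S hS; apply: ga; exact: leq_trans dd'. Qed.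

Lemma ext_order_geD d a b :
  ext_order_ge d a -> ext_order_ge d b -> ext_order_ge d (a + b).
Proof. by move=> ga gb S hS; rewrite extDE ga // gb // addr0. Qed.

Lemma ext_order_geN d a : ext_order_ge d a -> ext_order_ge d (- a).
Proof. by move=> ga S hS; rewrite extNE ga // oppr0. Qed.

Lemma ext_order_ge_big a : ext_order_ge m.+1 a -> a = 0.
Proof.
move=> ga; apply/ffunP => S; rewrite ga ?ffunE // ltnS.
by rewrite (leq_trans (max_card _)) // card_ord.
Qed.

Lemma ext_evenN a : ext_even a -> ext_even (- a).
Proof. by rewrite -scaleN1r; exact: ext_evenZ. Qed.

(** The geometric series for [1 / (1 + a)]; it stops because an element without
    body is nilpotent. *)
Definition geom_inv a : ext K m := \sum_(i < m.+1) (- a) ^+ i.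

Lemma geom_invP a : ext_order_ge 1 a -> (1 + a) * geom_inv a = 1.
Proof.
move=> ga; have := subrX1 (- a) m.+1.
rewrite ext_nilpotent; last exact: ext_order_geN.
by rewrite sub0r -opprD mulNr addrC => /oppr_inj.
Qed.

Lemma geom_inv_even a : ext_even a -> ext_even (geom_inv a).
Proof. by move=> ea; apply: ext_even_sum => i _; apply/ext_evenX/ext_evenN. Qed.

(** A product of generators taken in increasing order has no inversion, so
    no sign appears. *)
Lemma ext_monomialE S T : (ext_monomial S : ext K m) T = (T == S)%:R.
Proof.
pose pr (r : seq 'I_m) : ext K m := \prod_(i <- r) ext_gen i ^+ (i \in S).
have prE r : sorted (fun i j : 'I_m => (i < j)%N) r ->
    forall T, pr r T = (T == [set i in r | i \in S]%SET)%:R.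
  elim: r => [_ {}T|i r IHr ir {}T].
    rewrite /pr big_nil ext1E.
    by congr (_ == _)%:R.
  have /IHr{}IHr := path_sorted ir.
  rewrite /pr big_cons -/(pr r).
  have [iS|iS] := boolP (i \in S); last first.
    rewrite expr0 mul1r IHr; congr (_ == _)%:R; apply/finset.setP => j.
    by rewrite !inE; case: eqVneq => // ->; rewrite (negPf iS) !andbF.
  set U := [set i in r | i \in S]%SET in IHr.
  have -> : [set j in i :: r | j \in S]%SET = [set i]%SET :|: U.
    by apply/finset.setP => j; rewrite !inE; case: eqVneq => // ->.
  rewrite expr1 extME (bigD1 [set i]%SET) //= [X in _ + X]big1 => [|A nA].
    rewrite addr0 (eq_bigr (fun B =>
      if B == U then shuffle_sign K [set i]%SET U else 0)).
      rewrite -big_mkcondr /=.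
      have ltU j : j \in U -> (i < j)%N.
        rewrite !inE => /andP[jr _].
        have tr : transitive (fun i j : 'I_m => (i < j)%N).
          by move=> ? ? ?; exact: ltn_trans.
        exact: (allP (order_path_min tr ir)).
      have -> : shuffle_sign K [set i]%SET U = 1.
        rewrite /shuffle_sign disjoints1.
        case: ifP => [_|/negbFE/ltU]; last by rewrite ltnn.
        rewrite /inversions big_set1 big1 ?expr0 // => j /ltU ij.
        by rewrite ltnNge ltnW.
      rewrite (eq_bigl (fun B => (B == U) && (T == [set i]%SET :|: U))) => [|B].
        by rewrite big_mkcondr big_pred1_eq; case: ifP.
      by rewrite andbC; case: eqVneq => //= ->; rewrite eq_sym.
    move=> B _; rewrite ffunE eqxx mul1r IHr; case: eqVneq => [->|_] /=.
      by rewrite mulr1.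
    by rewrite mulr0.
  by rewrite big1 // => B _; rewrite ffunE (negPf nA) mul0r mulr0.
have -> : ext_monomial S = pr (index_enum 'I_m) by [].
rewrite prE; last first.
  rewrite [index_enum _]unlock -enumT; have := iota_ltn_sorted 0 m.
  by rewrite -val_enum_ord sorted_map.
by congr (_ == _)%:R; apply/finset.setP => j; rewrite !inE mem_index_enum.
Qed.

Lemma nilpotent_partE (c : {set 'I_m} -> nat -> K) (w : K) S :
  nilpotent_part c w S =
  if ~~ odd #|S| then \sum_(1 <= l < #|S|) c S l / w ^+ l else 0.
Proof.
rewrite /nilpotent_part ext_sumE.
pose F j : K := if #|S| == j.*2 then \sum_(1 <= l < j.*2) c S l / w ^+ l else 0.
have cS : (#|S| <= m)%N by rewrite (leq_trans (max_card _)) // card_ord.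
rewrite (eq_bigr F) => [|j _].
  case: ifP => [eS|oS]; last first.
    rewrite big1_seq // => j _; rewrite /F; case: eqP => // Sj.
    by rewrite Sj odd_double in oS.
  have S2 : #|S| = (#|S|./2).*2 by rewrite -[LHS]odd_double_half (negPf eS).
  case: (posnP #|S|) => [S0|S1].
    rewrite big_nat_cond big1; last first.
      by move=> j /andP[/andP[j1 _] _]; rewrite /F S0; case: eqP => //; lia.
    by rewrite S0 big_geq.
  rewrite (bigD1_seq #|S|./2) ?iota_uniq //=; last by rewrite mem_index_iota; lia.
  rewrite /F -S2 eqxx [X in _ + X]big1 ?addr0 // => j nj; case: eqP => // Sj; move: nj.
  by rewrite Sj doubleK eqxx.
rewrite ext_sumE /F; case: eqP => [Sj|nSj].
  rewrite (bigD1 S) ?Sj //= [X in _ + X]big1 => [|T /andP[_ nT]].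
    rewrite addr0 ext_sumE; apply: eq_bigr => l _.
    by rewrite extZE ext_monomialE eqxx mulr1.
  rewrite ext_sumE big1 // => l _.
  by rewrite extZE ext_monomialE eq_sym (negPf nT) mulr0.
rewrite big1 // => T /eqP Tj; rewrite ext_sumE big1 // => l _.
by rewrite extZE ext_monomialE; case: eqP => [ST|]; rewrite ?mulr0 // ST in nSj *.
Qed.

Lemma ext_rescaleE w a S : ext_rescale w a S = w ^- #|S| * a S.
Proof. by rewrite ffunE. Qed.

Lemma ext_rescaleD w a b :
  ext_rescale w (a + b) = ext_rescale w a + ext_rescale w b.
Proof. by apply/ffunP => S; rewrite !(ffunE, extDE) mulrDr. Qed.

Lemma ext_rescaleZ w k a : ext_rescale w (k *: a) = k *: ext_rescale w a.
Proof. by apply/ffunP => S; rewrite extZE !ext_rescaleE extZE; ring. Qed.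

Lemma ext_rescaleK w a : w != 0 -> ext_rescale w (ext_rescale w^-1 a) = a.
Proof.
move=> w0; apply/ffunP => S; rewrite !ext_rescaleE mulrA exprVn invrK mulVf ?mul1r //.
by rewrite expf_neq0.
Qed.

Lemma ext_rescale_even w a : ext_even a -> ext_even (ext_rescale w a).
Proof. by move=> ea S oS; rewrite ext_rescaleE ea // mulr0. Qed.

Lemma ext_rescale_order w d a : ext_order_ge d a -> ext_order_ge d (ext_rescale w a).
Proof. by move=> ga S hS; rewrite ext_rescaleE ga // mulr0. Qed.

End ExteriorCalculus.

(** * Functions of one variable *)

Section FunctionRings.
Variables (K : fieldType) (m : nat).
Implicit Types (A : set K) (P : (K -> K) -> Prop).

(** The functions regular on a set and the functions Laurent at a point enter the
    argument in the same way, through closure under ring operations; [coefs_in]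
    lifts either class to functions with values in the exterior algebra. *)
Definition function_ring P := [/\ forall c, P (fun=> c),
  forall f g, P f -> P g -> P (fun x => f x + g x) &
  forall f g, P f -> P g -> P (fun x => f x * g x)].

Definition coefs_in P (f : K -> ext K m) := forall S, P (fun x => f x S).

Lemma function_ring_sum P (I : Type) (r : seq I) (Q : pred I) (f : I -> K -> K) :
  function_ring P -> (forall i, Q i -> P (f i)) ->
  P (fun x => \sum_(i <- r | Q i) f i x).
Proof.
move=> [Pc PD PM] Pf; elim: r => [|i r IHr].
  by under [X in P X]funext => x do rewrite big_nil; exact: Pc.
under [X in P X]funext => x do rewrite big_cons.
by case: (boolP (Q i)) => // /Pf Pi; apply: PD.
Qed.

Section Coefficients.
Variable (P : (K -> K) -> Prop).
Hypothesis PR : function_ring P.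
Implicit Types f g : K -> ext K m.

Lemma coefs_in_cst a : coefs_in P (fun=> a).
Proof. by have [Pc _ _] := PR; move=> S; exact: Pc. Qed.

Lemma coefs_inD f g : coefs_in P f -> coefs_in P g -> coefs_in P (fun x => f x + g x).
Proof.
have [_ PD _] := PR; move=> Pf Pg S.
by under [X in P X]funext => x do rewrite extDE; exact: PD.
Qed.

Lemma coefs_inZ (k : K -> K) f : P k -> coefs_in P f -> coefs_in P (fun x => k x *: f x).
Proof.
have [_ _ PM] := PR; move=> Pk Pf S.
by under [X in P X]funext => x do rewrite extZE; exact: PM.
Qed.

Lemma coefs_inN f : coefs_in P f -> coefs_in P (fun x => - f x).
Proof.
have [Pc _ _] := PR; move=> Pf; under [X in coefs_in P X]funext => x do rewrite -scaleN1r.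
exact: coefs_inZ.
Qed.

Lemma coefs_inM f g : coefs_in P f -> coefs_in P g -> coefs_in P (fun x => f x * g x).
Proof.
have [Pc _ PM] := PR; move=> Pf Pg S.
under [X in P X]funext => x do rewrite extME.
do 2!apply: function_ring_sum => // ? _.
by do 2![apply: (PM) => //].
Qed.

Lemma coefs_in_sum (I : Type) (r : seq I) (Q : pred I) (f : I -> K -> ext K m) :
  (forall i, Q i -> coefs_in P (f i)) ->
  coefs_in P (fun x => \sum_(i <- r | Q i) f i x).
Proof.
move=> Pf S; under [X in P X]funext => x do rewrite ext_sumE.
by apply: function_ring_sum => // i /Pf.
Qed.

Lemma coefs_inX f n : coefs_in P f -> coefs_in P (fun x => f x ^+ n).
Proof.
move=> Pf; elim: n => [|n IHn]; first exact: coefs_in_cst.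
by under [X in coefs_in P X]funext => x do rewrite exprS; exact: coefs_inM.
Qed.

Lemma coefs_in_geom_inv f : coefs_in P f -> coefs_in P (fun x => geom_inv (f x)).
Proof. by move=> Pf; apply: coefs_in_sum => i _; apply/coefs_inX/coefs_inN. Qed.

End Coefficients.

Lemma regular_fun_ring A : function_ring (@regular_fun K A).
Proof.
by split; [exact: regular_cst|exact: regularD|exact: regularM].
Qed.

Definition laurent_at (p : K) (f : K -> K) :=
  exists (a : {poly K}) k, forall x, x != p -> f x = a.[x] / (x - p) ^+ k.

Lemma laurent_ring p : function_ring (laurent_at p).
Proof.
split=> [c|f g [a [k fE]] [b [l gE]]|f g [a [k fE]] [b [l gE]]].
- by exists c%:P, 0 => x _; rewrite hornerC expr0 divr1.
- exists (a * ('X - p%:P) ^+ l + b * ('X - p%:P) ^+ k), (k + l)%N => x xp.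
  have uk n : (x - p) ^+ n != 0 by rewrite expf_neq0 // subr_eq0.
  rewrite fE // gE // hornerD !hornerM !horner_exp hornerXsubC exprD; move: (uk k) (uk l).
  move: (_ ^+ k) (_ ^+ l) => u v u0 v0; field.
  by rewrite u0 v0.
- exists (a * b), (k + l)%N => x xp.
  by rewrite fE // gE // hornerM exprD invfM; ring.
Qed.

Lemma laurent_at_exp p (k : int) : laurent_at p (fun x => (x - p) ^ k).
Proof.
case: k => k; first by exists (('X - p%:P) ^+ k), 0 => x _; rewrite !hornerE expr0 divr1.
by exists 1, k.+1 => x _; rewrite NegzE -exprnN hornerC div1r.
Qed.

Lemma laurent_regular p f : laurent_at p f -> regular_fun [set x | x != p] f.
Proof.
move=> [a [k fE]] q qp; exists (a, ('X - p%:P) ^+ k) => /= [|x xp _].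
  by rewrite !hornerE expf_neq0 // subr_eq0.
by rewrite fE // !hornerE.
Qed.

Lemma regular_poly A (f : {poly K}) : regular_fun A (horner f).
Proof.
move=> p _; exists (f, 1) => [|x _ _] /=; first by rewrite hornerE oner_neq0.
by rewrite hornerE divr1.
Qed.

Lemma regular_fraction A (a b : {poly K}) :
  (forall x, A x -> b.[x] != 0) -> regular_fun A (fun x => a.[x] / b.[x]).
Proof. by move=> b0 p /b0 bp; exists (a, b). Qed.

(** Inverting the variable turns a polynomial into its reversal divided by a
    power of the variable. *)
Lemma laurent_poly_inv (a : {poly K}) : laurent_at 0 (fun x => a.[x^-1]).
Proof.
elim/poly_ind: a => [|a c [q [n qE]]].
  by exists 0, 0%N => x _; rewrite !horner0 mul0r.
exists (q + c%:P * 'X^(n.+1)), n.+1 => x x0.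
have xn : x ^+ n != 0 by rewrite expf_neq0.
rewrite !(hornerD, hornerM, hornerC, hornerX, hornerXn) qE // subr0 exprS.
move: (x ^+ n) xn => u u0; field.
by rewrite x0 u0.
Qed.

Lemma laurent_inv f : laurent_at 0 f -> laurent_at 0 (fun x => f x^-1).
Proof.
move=> [a [k fE]]; have [_ _ lM] := laurent_ring 0.
have [b [n bE]] : laurent_at 0 (fun x => a.[x^-1] * x ^+ k).
  apply: lM; first exact: laurent_poly_inv.
  by exists 'X^k, 0%N => x _; rewrite !hornerE expr0 divr1.
exists b, n => x x0; rewrite -bE // fE ?invr_eq0 //.
by rewrite subr0 exprVn invrK.
Qed.

Lemma regular_inv_comp A f : regular_fun A f ->
  regular_fun [set x | x != 0 /\ A x^-1] (fun x => f x^-1).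
Proof.
move=> rf p [p0 /rf [[a b] /= bp fE]].
have [qa [na aE]] := laurent_poly_inv a; have [qb [nb bE]] := laurent_poly_inv b.
have nz x : x != 0 -> (b.[x^-1] != 0) = (qb.[x] != 0).
  by move=> x0; rewrite bE // subr0 mulf_eq0 invr_eq0 expf_eq0 (negPf x0) andbF orbF.
exists (qa * 'X^nb, qb * 'X^na) => /= [|x [x0 Ax]].
  by rewrite !hornerE mulf_neq0 ?expf_neq0 // -nz.
rewrite !(hornerM, hornerXn) mulf_eq0 negb_or => /andP[bx _].
have xn n : x ^+ n != 0 by rewrite expf_neq0.
rewrite fE ?nz // aE // bE // !subr0; move: (xn na) (xn nb).
move: (x ^+ na) (x ^+ nb) => u v u0 v0; field.
by rewrite bx u0 v0.
Qed.

Lemma zariski_open_inv A : zariski_open A -> zariski_open [set x : K | x != 0 /\ A x^-1].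
Proof.
move=> oA p [p0 /oA[f fp fA]].
have [q [n qE]] := laurent_poly_inv f.
have nz x : x != 0 -> (f.[x^-1] != 0) = (q.[x] != 0).
  by move=> x0; rewrite qE // subr0 mulf_eq0 invr_eq0 expf_eq0 (negPf x0) andbF orbF.
exists (q * 'X) => [|x]; rewrite !hornerE; first by rewrite mulf_neq0 // -nz.
by rewrite mulf_eq0 negb_or => /andP[qx x0]; split=> //; apply: fA; rewrite nz.
Qed.

Lemma zariski_open_nonroot (f : {poly K}) : zariski_open [set x | f.[x] != 0].
Proof. by move=> p fp; exists f. Qed.

Lemma poly_root_seq (f : {poly K}) : f != 0 ->
  exists s : seq K, forall x, root f x -> x \in s.
Proof.
have [n] := ubnP (size f); elim: n f => // n IHn f fn f0.
have [[x fx]|nr] := pselect (exists x, root f x); last first.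
  by exists [::] => x fx; case: nr; exists x.
have /factor_theorem[g fE] := fx.
have g0 : g != 0 by apply: contraNneq f0 => g0; rewrite fE g0 mul0r.
have [|s sP] := IHn g _ g0.
  by move: fn; rewrite fE size_Mmonic ?monicXsubC // size_XsubC addn2.
exists (x :: s) => y; rewrite fE rootM root_XsubC inE => /orP[/sP->|->] //.
by rewrite orbT.
Qed.

End FunctionRings.

(** * Factorization at a point *)

Section LocalFactorization.
Variables (K : numFieldType) (m : nat).
Implicit Types (A : set K) (p : K).

Lemma poly_nonroot (f : {poly K}) : f != 0 -> exists x, f.[x] != 0.
Proof.
move=> f0; apply: contrapT => nr.
(* A nonzero polynomial cannot vanish at all of 0, ..., size f - 1. *)
pose rs := [seq n%:R : K | n <- iota 0 (size f)].
have : (size rs < size f)%N.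
  apply: max_poly_roots => //.
    by apply/allP => x _; apply/eqP/eqP; apply: contrapT => /negP fx; apply: nr; exists x.
  by rewrite map_inj_uniq ?iota_uniq // => i j /eqP; rewrite eqr_nat => /eqP.
by rewrite size_map size_iota ltnn.
Qed.

Lemma horner_neq0 (f : {poly K}) x : f.[x] != 0 -> f != 0.
Proof. by apply: contraNneq => ->; rewrite horner0. Qed.

(** [K] is infinite, so nonempty open sets meet. *)
Lemma zariski_dense A p (f : {poly K}) : zariski_open A -> A p -> f != 0 ->
  exists q, [/\ A q, q != p & f.[q] != 0].
Proof.
move=> oA /oA[g gp gA] f0.
have [|q] := @poly_nonroot (f * g * ('X - p%:P)).
  by rewrite !mulf_neq0 ?polyXsubC_eq0 ?(horner_neq0 gp).
rewrite !hornerM hornerXsubC !mulf_eq0 !negb_or subr_eq0 => /andP[/andP[fq gq] qp].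
by exists q; split=> //; exact: gA.
Qed.

Lemma poly_multiplicity p (f : {poly K}) : f != 0 ->
  exists (g : {poly K}) k, g.[p] != 0 /\ f = g * ('X - p%:P) ^+ k.
Proof.
by move=> f0; have [k [g gp ->]] := multiplicity_XsubC f p; exists g, k; rewrite f0 in gp.
Qed.

Lemma regular_punctured A p f : zariski_open A -> A p ->
  regular_fun (A `\ p) f -> exists (a b : {poly K}) k,
  b.[p] != 0 /\
  forall x, A x -> x != p -> b.[x] != 0 -> f x = a.[x] / ((x - p) ^+ k * b.[x]).
Proof.
move=> oA Ap rf; have [q [Aq qp _]] := zariski_dense oA Ap (oner_neq0 _).
have [|[a c] /= cq fE] := rf q; first by split=> //; apply/eqP.
have [b [k [bp cE]]] := poly_multiplicity p (horner_neq0 cq).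
exists a, b, k; split=> // x Ax xp bx.
have cx : c.[x] = (x - p) ^+ k * b.[x].
  by rewrite cE hornerM horner_exp hornerXsubC mulrC.
rewrite fE ?cx //; first by split=> //; apply/eqP.
by rewrite mulf_neq0 // expf_neq0 // subr_eq0.
Qed.

(** The bound [l] is the order of the pole of [f] at [p]. Any larger exponent is
    allowed, so that one exponent serves for all coefficients of an element of the
    exterior algebra. *)
Lemma regular_clear_pole A p f : zariski_open A -> A p ->
  regular_fun (A `\ p) f -> exists l, forall M, (l <= M)%N ->
  exists (b : {poly K}) g, [/\ b.[p] != 0, regular_fun [set x | b.[x] != 0] g &
    forall x, A x -> x != p -> b.[x] != 0 -> (x - p) ^+ M * f x = g x].
Proof.
move=> oA Ap /(regular_punctured oA Ap)[a [b [l [bp fE]]]]; exists l => M lM.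
exists b, (fun x => (a * ('X - p%:P) ^+ (M - l)).[x] / b.[x]); split=> //.
  exact: regular_fraction.
move=> x Ax xp bx; rewrite fE // hornerM horner_exp hornerXsubC -{1}(subnK lM) exprD.
have : (x - p) ^+ l != 0 by rewrite expf_neq0 // subr_eq0.
move: (_ ^+ l) (_ ^+ (M - l)) => u v u0; field.
by rewrite u0 bx.
Qed.

(** Laurent functions are dense among the functions regular near a punctured
    point: with [f = a / ((x - p)^k b)] and a Bezout relation
    [U b + V (x - p)^(k + M) = 1], the Laurent function [a U / (x - p)^k] differs
    from [f] by [(x - p)^M a V / b]. *)
Lemma regular_laurent_approx A p f M : zariski_open A -> A p ->
  regular_fun (A `\ p) f -> exists (b : {poly K}) h e,
  [/\ b.[p] != 0, laurent_at p h, regular_fun [set x | b.[x] != 0] e &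
    forall x, A x -> x != p -> b.[x] != 0 -> f x = h x + (x - p) ^+ M * e x].
Proof.
move=> oA Ap /(regular_punctured oA Ap)[a [b [k [bp fE]]]].
have /Bezout_eq1_coprimepP[[U V] /= UV] : coprimep b (('X - p%:P) ^+ (k + M)).
  by apply: coprimep_expr; rewrite coprimep_XsubC.
exists b, (fun x => (a * U).[x] / (x - p) ^+ k), (fun x => (a * V).[x] / b.[x]).
split=> //; first by exists (a * U), k.
  exact: regular_fraction.
move=> x Ax xp bx; rewrite fE // !hornerM.
have := congr1 (horner^~ x) UV.
rewrite hornerD !hornerM horner_exp hornerXsubC hornerC exprD.
have : (x - p) ^+ k != 0 by rewrite expf_neq0 // subr_eq0.
move: (_ ^+ k) (_ ^+ M) => u v u0 UV1.
rewrite -[a.[x] in LHS]mulr1 -UV1; field.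
by rewrite u0 bx.
Qed.

Let poly_common_nonzero (I : finType) p (b : I -> {poly K}) :
  (forall i, (b i).[p] != 0) ->
  exists c : {poly K}, c.[p] != 0 /\ forall i x, c.[x] != 0 -> (b i).[x] != 0.
Proof.
move=> bp; exists (\prod_i b i); rewrite horner_prod; split.
  by apply/prodf_neq0 => i _.
by move=> i x; rewrite horner_prod => /prodf_neq0/(_ i isT).
Qed.

(** Let [1 + n] be a Laurent approximation of [f] to an order [M] that
    clears the poles of the inverse [g]. Then [g (1 + n) = 1 - g (f - 1 - n)] is
    regular at [p], and it is invertible because its body is 1. *)
Lemma unipotent_local_factor A p (f g : K -> ext K m) :
  zariski_open A -> A p ->
  coefs_in (regular_fun (A `\ p)) f -> coefs_in (regular_fun (A `\ p)) g ->
  (forall x, A x -> x != p -> [/\ ext_even (f x), ext_even (g x),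
     f x * g x = 1 & f x finset.set0 = 1]) ->
  exists (c : {poly K}) n u v,
    [/\ c.[p] != 0, coefs_in (laurent_at p) n,
        coefs_in (regular_fun [set x | c.[x] != 0]) u &
        coefs_in (regular_fun [set x | c.[x] != 0]) v] /\
    [/\ forall x, ext_even (n x) /\ ext_order_ge 1 (n x),
        forall x, [/\ ext_even (u x), ext_even (v x) & u x * v x = 1] &
        forall x, A x -> x != p -> c.[x] != 0 -> f x = (1 + n x) * u x].
Proof.
move=> oA Ap rf rg fg.
have /choice[l lP] S := regular_clear_pole oA Ap (rg S).
pose M := (\sum_S l S)%N.
have lM S : (l S <= M)%N by rewrite /M (bigD1 S) //= leq_addr.
have /choice[b1 b1P] S := lP S M (lM S).
have /choice[h hP] := b1P.
have /choice[b2 b2P] S := regular_laurent_approx M oA Ap (rf S).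
have /choice[a aP] := b2P.
have /choice[e eP] := aP.
have [|c1 [c1p c1P]] := @poly_common_nonzero _ p b1; first by move=> S; case: (hP S).
have [|c2 [c2p c2P]] := @poly_common_nonzero _ p b2; first by move=> S; case: (eP S).
(* Near [p] but off [p], [f] and [g] are even and [f - 1] has no body, so dropping
   those coefficients loses nothing there and makes the new functions even, and
   [n] and [E] without body, at every point. *)
pose mask (k : {set 'I_m} -> K -> K) x : ext K m :=
  [ffun S : {set 'I_m} => if ~~ odd #|S| && (S != finset.set0) then k S x else 0].
pose C x : ext K m := [ffun S : {set 'I_m} => if ~~ odd #|S| then h S x else 0].
have maskP P k : function_ring P -> (forall S, P (k S)) -> coefs_in P (mask k).
  move=> [Pc _ _] Pk S; under [X in P X]funext => x do rewrite ffunE.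
  by case: (~~ odd #|S| && (S != finset.set0)).
have mask_even k x : ext_even (mask k x) by move=> S oS; rewrite ffunE oS.
have mask_ord k x : ext_order_ge 1 (mask k x).
  by move=> S; rewrite ltnS leqn0 cards_eq0 => /eqP->; rewrite ffunE eqxx andbF.
have CP P : function_ring P -> (forall S, P (h S)) -> coefs_in P C.
  move=> [Pc _ _] Pk S; under [X in P X]funext => x do rewrite ffunE.
  by case: (~~ odd #|S|).
have C_even x : ext_even (C x) by move=> S oS; rewrite ffunE oS.
pose E := mask e; pose n := mask a.
have ec x : ext_even (E x * C x) by apply: ext_evenM => //; exact: mask_even.
have eco x : ext_order_ge 1 (- (E x * C x)).
  apply: ext_order_geN; rewrite -[1%N]addn0; apply: ext_order_geM => //.
  exact: mask_ord.
have Rc : function_ring (regular_fun [set x | (c1 * c2).[x] != 0]).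
  exact: regular_fun_ring.
have rEC : coefs_in (regular_fun [set x | (c1 * c2).[x] != 0]) (fun x => - (E x * C x)).
  apply: coefs_inN => //; apply: coefs_inM => //.
    apply: maskP => // S; have [_ _ re _] := eP S; apply: regularS re => x /=.
    by rewrite hornerM mulf_eq0 negb_or => /andP[_ /c2P].
  apply: CP => // S; have [_ rh _] := hP S; apply: regularS rh => x /=.
  by rewrite hornerM mulf_eq0 negb_or => /andP[/c1P].
exists (c1 * c2), n, (fun x => geom_inv (- (E x * C x))), (fun x => 1 - E x * C x).
split; split.
- by rewrite hornerM mulf_neq0.
- by apply: maskP => [|S]; [exact: laurent_ring|case: (eP S)].
- exact: coefs_in_geom_inv.
- by apply: coefs_inD => //; exact: coefs_in_cst.
- by move=> x; split; [exact: mask_even|exact: mask_ord].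
- move=> x; have ev : ext_even (geom_inv (- (E x * C x))).
    exact/geom_inv_even/ext_evenN.
  split=> //; first by apply: ext_evenD; [exact: ext_even1|exact: ext_evenN].
  by rewrite ext_evenC // geom_invP.
move=> x Ax xp; rewrite hornerM mulf_eq0 negb_or => /andP[c1x c2x].
have [ef eg fg1 f1] := fg x Ax xp.
have gC : (x - p) ^+ M *: g x = C x.
  apply/ffunP => S; rewrite extZE ffunE; case: ifP => [_|/negbFE oS].
    by have [_ _ ->] := hP S => //; exact: c1P.
  by rewrite eg // mulr0.
have fE : f x = 1 + n x + (x - p) ^+ M *: E x.
  apply/ffunP => S; rewrite !extDE extZE ext1E !ffunE.
  have [->|S0] := eqVneq S finset.set0; first by rewrite andbF f1 mulr0 !addr0.
  rewrite andbT; case: ifP => [_|/negbFE oS]; last by rewrite ef // mulr0 !addr0.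
  by rewrite add0r; have [_ _ _ ->] := eP S => //; exact: c2P.
have gn : g x * (1 + n x) = 1 - E x * C x.
  have -> : 1 + n x = f x - (x - p) ^+ M *: E x by rewrite fE addrK.
  rewrite mulrBr -(ext_evenC _ ef) fg1 -gC -!scalerAr; congr (1 - _ *: _).
  exact: ext_evenC.
by rewrite -[LHS]mulr1 -[X in _ * X = _](geom_invP (eco x)) -gn !mulrA fg1 mul1r.
Qed.

(** Dividing by the body, which is a power of [x - p] times a unit at [p],
    reduces the general case to the unipotent one. *)
Lemma local_factor A p (f g : K -> ext K m) :
  zariski_open A -> A p ->
  coefs_in (regular_fun (A `\ p)) f -> coefs_in (regular_fun (A `\ p)) g ->
  (forall x, A x -> x != p -> [/\ ext_even (f x), ext_even (g x) & f x * g x = 1]) ->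
  exists (B : set K) (k : int) n u v,
    [/\ zariski_open B, B p & B `<=` A] /\
    [/\ coefs_in (laurent_at p) n, coefs_in (regular_fun B) u &
        coefs_in (regular_fun B) v] /\
    [/\ forall x, ext_even (n x) /\ ext_order_ge 1 (n x),
        forall x, B x -> [/\ ext_even (u x), ext_even (v x) & u x * v x = 1] &
        forall x, B x -> x != p -> f x = (x - p) ^ k *: ((1 + n x) * u x)].
Proof.
move=> oA Ap rf rg fg.
pose f0 x := f x finset.set0; pose g0 x := g x finset.set0.
have fg0 x : A x -> x != p -> f0 x * g0 x = 1.
  by move=> Ax xp; have [_ _ /(congr1 (fun a : ext K m => a finset.set0))] := fg x Ax xp;
    rewrite ext_mul_body ext1E eqxx.
have rA := regular_fun_ring (A `\ p).
have [| | |c [n [u [v [[cp nL ru rv] [nP uP fE]]]]]] :=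
  @unipotent_local_factor A p (fun x => g0 x *: f x) (fun x => f0 x *: g x) oA Ap.
- by apply: coefs_inZ => //; exact: rg.
- by apply: coefs_inZ => //; exact: rf.
- move=> x Ax xp; have [ef eg fgx] := fg x Ax xp; split; try exact: ext_evenZ.
    by rewrite -scalerAl -scalerAr scalerA fgx mulrC fg0 // scale1r.
  by rewrite extZE mulrC fg0.
have [a [b [k [bp f0E]]]] := regular_punctured oA Ap (rf finset.set0).
have [q [Aq qp bq]] := zariski_dense oA Ap (horner_neq0 bp).
have /poly_multiplicity-/(_ p)[a1 [l [a1p aE]]] : a != 0.
  apply: contraTneq (oner_neq0 K) => a0.
  by rewrite -(fg0 q) // /f0 f0E // a0 horner0 !mul0r eqxx.
pose d := a1 * b * c; pose r x := a1.[x] / b.[x]; pose s x := b.[x] / a1.[x].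
have dP x : d.[x] != 0 -> [/\ a1.[x] != 0, b.[x] != 0 & c.[x] != 0].
  by rewrite !hornerM !mulf_eq0 !negb_or => /andP[/andP[? ?] ?].
pose B := A `&` [set x | d.[x] != 0].
have rB := regular_fun_ring B.
exists B, (l%:Z - k%:Z), n, (fun x => r x *: u x), (fun x => s x *: v x).
split; split.
- by apply: zariski_openI => //; exact: zariski_open_nonroot.
- by split=> //=; rewrite !hornerM !mulf_neq0.
- by move=> x [].
- split=> //; apply: coefs_inZ => //.
  + by apply: regular_fraction => x [_ /dP[]].
  + by move=> S; apply: regularS (ru S) => x [_ /dP[]].
  + by apply: regular_fraction => x [_ /dP[]].
  + by move=> S; apply: regularS (rv S) => x [_ /dP[]].
split=> // [x [Ax /dP[a1x bx cx]]|x [Ax /dP[a1x bx cx]] xp].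
  have [eu ev uv] := uP x; split; try exact: ext_evenZ.
  rewrite -scalerAl -scalerAr scalerA uv /r /s.
  by rewrite mulrA divfK // divff // scale1r.
have xpn j : (x - p) ^+ j != 0 by rewrite expf_neq0 // subr_eq0.
rewrite -scalerAr -fE // !scalerA.
rewrite (_ : _ * g0 x = 1) ?scale1r //.
rewrite -(fg0 x) //; congr (_ * _); rewrite /f0 f0E // aE /r.
rewrite expfzDr ?subr_eq0 // -exprnN hornerM horner_exp hornerXsubC.
rewrite -exprnP; move: (xpn k) (_ ^+ l) => {}xpn z; field.
by rewrite bx xpn.
Qed.

End LocalFactorization.

(** * Sections over one chart *)

Section Charts.
Variables (K : fieldType) (m : nat).
Implicit Types (W : set (projline K)) (w z : K) (s t : expr K m).
Implicit Types (f g : K -> ext K m).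

Local Notation "s ** t" := (expr_mul s t) (at level 40, left associativity).

Definition of_chartU f : expr K m := (f, fun w => ext_rescale w (f w^-1)).

Lemma ptU_inv w : w != 0 -> ptU w^-1 = ptV w.
Proof. by move=> w0; rewrite /ptU invr_eq0 (negPf w0) invrK. Qed.

Lemma ptU_neq0 z : z != 0 -> ptU z = ptV z^-1.
Proof. by move=> z0; rewrite /ptU (negPf z0). Qed.

Lemma chartU_ptV w : chartU (ptV w) <-> w != 0.
Proof.
split=> [Uw|/ptU_inv <-]; last by exists w^-1.
by apply/overlap_ptV; split=> //; exists w.
Qed.

Lemma chartV_ptU z : chartV (ptU z) <-> z != 0.
Proof.
split=> [Vz|/ptU_neq0 ->]; last by exists z^-1.
by apply/overlap_ptU; split=> //; exists z.
Qed.

Lemma open_chartV_image (A : set K) : zariski_open A ->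
  open [set x : projline K | if x is Some w then A w else False].
Proof.
move=> oA; split=> //= z; rewrite /= /ptU; case: eqP => // /eqP z0 Az.
have [f fz fA] := zariski_open_inv oA (conj z0 Az).
by exists f => // x /fA[/negPf -> ].
Qed.

Lemma open_chartU_image (A : set K) : zariski_open A ->
  open [set x : projline K | if x is Some w then w != 0 /\ A w^-1 else A 0].
Proof.
move=> oA; split; last exact: zariski_open_inv.
have E x : (if @ptU K x is Some w then w != 0 /\ A w^-1 else A 0) <-> A x.
  rewrite /ptU; have [->//|x0] := eqVneq x 0.
  by rewrite invr_eq0 invrK; split=> [[]|].
by move=> z /E/oA[f fz fA]; exists f => // x /fA/E.
Qed.

Lemma of_chartV_even_section W f : W `<=` @chartV K ->
  coefs_in (regular_fun (@ptV K @^-1` W)) f ->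
  (forall w, W (ptV w) -> ext_even (f w)) -> even_section W (of_chartV f).
Proof.
move=> WV rf ef; have WU z : W (ptU z) -> z != 0 /\ W (ptV z^-1).
  by move=> Wz; have z0 := ((chartV_ptU z).1 (WV _ Wz)); rewrite -ptU_neq0.
split; last by split=> [z /WU[_ /ef]|] //=; exact: ext_rescale_even.
split=> [S||w w0 _] //=; last by rewrite invrK ext_rescaleK.
have sub : @ptU K @^-1` W `<=` [set z | z != 0 /\ (@ptV K @^-1` W) z^-1] by [].
apply: (regularS sub) => /=.
under [X in regular_fun _ X]funext => x do rewrite ffunE -exprVn.
apply: regularM; last exact: (regular_inv_comp (rf S)).
apply: (@regularS _ _ [set z | z != 0]) => [z []//|].
by apply: regularX; exact: regular_inv.
Qed.

Lemma of_chartU_even_section W f : W `<=` @chartU K ->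
  coefs_in (regular_fun (@ptU K @^-1` W)) f ->
  (forall z, W (ptU z) -> ext_even (f z)) -> even_section W (of_chartU f).
Proof.
move=> WU rf ef; have WV w : W (ptV w) -> w != 0 /\ W (ptU w^-1).
  by move=> Ww; have w0 := (chartU_ptV w).1 (WU _ Ww); rewrite ptU_inv.
split; last by split=> [|w /WV[_ /ef]] //=; exact: ext_rescale_even.
split=> [|S|w w0 _] //=.
have sub : @ptV K @^-1` W `<=` [set z | z != 0 /\ (@ptU K @^-1` W) z^-1] by [].
apply: (regularS sub) => /=.
under [X in regular_fun _ X]funext => x do rewrite ffunE -exprVn.
apply: regularM; last exact: (regular_inv_comp (rf S)).
apply: (@regularS _ _ [set z | z != 0]) => [z []//|].
by apply: regularX; exact: regular_inv.
Qed.

Lemma section_chartV W s z : is_section W s -> z != 0 -> W (ptU z) ->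
  s.1 z = ext_rescale z (s.2 z^-1).
Proof.
move=> [_ _ sE] z0; rewrite ptU_neq0 // => Wz.
by rewrite sE ?invr_eq0 // invrK ext_rescaleK.
Qed.

(** The gluing relation determines the other expression of a section. *)
Lemma eq_on_chartV W s t : W `<=` @chartV K -> is_section W s -> is_section W t ->
  (forall w, W (ptV w) -> s.2 w = t.2 w) -> eq_on W s t.
Proof.
move=> WV sW tW st; split=> // z Wz; have z0 := ((chartV_ptU z).1 (WV _ Wz)).
by rewrite (section_chartV sW) // (section_chartV tW) // st // -[ptV _]ptU_neq0.
Qed.

Lemma eq_on_chartU W s t : W `<=` @chartU K -> is_section W s -> is_section W t ->
  (forall z, W (ptU z) -> s.1 z = t.1 z) -> eq_on W s t.
Proof.
move=> WU [_ _ sE] [_ _ tE] st; split=> // w Ww.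
have w0 := (chartU_ptV w).1 (WU _ Ww).
by rewrite sE // tE // st // ptU_inv.
Qed.

Lemma of_chartV_even_unit W f g : W `<=` @chartV K ->
  coefs_in (regular_fun (@ptV K @^-1` W)) f ->
  coefs_in (regular_fun (@ptV K @^-1` W)) g ->
  (forall w, W (ptV w) -> [/\ ext_even (f w), ext_even (g w) & f w * g w = 1]) ->
  even_unit W (of_chartV f).
Proof.
move=> WV rf rg fg.
have sf : even_section W (of_chartV f).
  by apply: of_chartV_even_section => // w /fg[].
have sg : even_section W (of_chartV g).
  by apply: of_chartV_even_section => // w /fg[].
split=> //; exists (of_chartV g) => //; apply: eq_on_chartV => //.
- by have [] := even_sectionM sf sg.
- by have [] := @even_section1 K m W.
- by move=> w /fg[].
Qed.

Lemma of_chartU_even_unit W f g : W `<=` @chartU K ->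
  coefs_in (regular_fun (@ptU K @^-1` W)) f ->
  coefs_in (regular_fun (@ptU K @^-1` W)) g ->
  (forall z, W (ptU z) -> [/\ ext_even (f z), ext_even (g z) & f z * g z = 1]) ->
  even_unit W (of_chartU f).
Proof.
move=> WU rf rg fg.
have sf : even_section W (of_chartU f).
  by apply: of_chartU_even_section => // w /fg[].
have sg : even_section W (of_chartU g).
  by apply: of_chartU_even_section => // w /fg[].
split=> //; exists (of_chartU g) => //; apply: eq_on_chartU => //.
- by have [] := even_sectionM sf sg.
- by have [] := @even_section1 K m W.
- by move=> w /fg[].
Qed.

Lemma even_unit_section W s : even_unit W s -> is_section W s.
Proof. by case=> -[]. Qed.

Lemma even_unit_even W s : even_unit W s -> even_on W s.
Proof. by case=> -[]. Qed.

Let transport_inverse (A : nzRingType) (a b g gi g' gi' : A) :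
  a * g' = g * b -> gi * g = 1 -> g' * gi' = 1 -> b * gi' = gi * a.
Proof.
move=> ag' gi1 g'1.
by rewrite -[RHS]mulr1 -g'1 mulrA -(mulrA gi) ag' !mulrA gi1 mul1r.
Qed.

(** The units [a] and [b] are changes of frame over U and V. *)
Lemma class_of_glue_eq (g g' a b : expr K m)
    (hg : even_unit (@overlap K) g) (hg' : even_unit (@overlap K) g') :
  even_unit (@chartU K) a -> even_unit (@chartV K) b ->
  eq_on (@overlap K) (a ** g') (g ** b) ->
  class_of (glue hg) = class_of (glue hg').
Proof.
move=> ua ub ab; apply/class_ofP.
exists (@glue_opn K), (fun x => if x is Some _ then b else a); split.
- exact: glue_open.
- exact: glue_mem.
- by move=> x y.
- by case.
have [_ gi] := even_unit_invP hg; have [_ gi'] := even_unit_invP hg'.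
have [eU eV] := even_unit_even hg.
case=> [w|] [w'|] /=; rewrite ?expr_mul1 ?expr_mulr1 //.
rewrite setIC; split=> x Ox /=.
- apply: (transport_inverse (ab.1 x Ox) _ (gi'.1 x Ox)).
  by rewrite -(ext_evenC _ (eU x Ox)); exact: gi.1.
- apply: (transport_inverse (ab.2 x Ox) _ (gi'.2 x Ox)).
  by rewrite -(ext_evenC _ (eV x Ox)); exact: gi.2.
Qed.

Lemma class_of_glueM (g g' : expr K m) (hg : even_unit (@overlap K) g)
    (hg' : even_unit (@overlap K) g') (hgg' : even_unit (@overlap K) (g ** g')) :
  class_of (glue hgg') = Pic0_mul (class_of (glue hg)) (class_of (glue hg')).
Proof.
rewrite -class_of_mul; apply/class_ofP/eq_cohomologous.
have [ui gi] := even_unit_invP hg; have [ui' gi'] := even_unit_invP hg'.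
have [uk gk] := even_unit_invP hgg'.
have inv_mul (a a' k h h' : ext K m) : ext_even a -> ext_even a' -> ext_even h' ->
    a * a' * k = 1 -> a * h = 1 -> a' * h' = 1 -> h * h' = k.
  move=> ea ea' eh' ak ah a'h'.
  rewrite -(ext_evenC _ eh') -[LHS]mulr1 -ak !mulrA -(mulrA h') -(ext_evenC _ ea) ah.
  by rewrite mulr1 -(ext_evenC _ ea') a'h' mul1r.
case=> [w|] [w'|] /=; rewrite ?expr_mul1 //.
apply: (@eq_onS _ _ _ (@overlap K)) => [x [[? _] [? _]]//|].
split=> x Ox /=.
- apply: inv_mul (gk.1 x Ox) (gi.1 x Ox) (gi'.1 x Ox).
  + exact: (even_unit_even hg).1.
  + exact: (even_unit_even hg').1.
  + exact: (even_unit_even ui').1.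
- apply: inv_mul (gk.2 x Ox) (gi.2 x Ox) (gi'.2 x Ox).
  + exact: (even_unit_even hg).2.
  + exact: (even_unit_even hg').2.
  + exact: (even_unit_even ui').2.
Qed.

End Charts.

(** * Extending a frame point by point *)

Section Trivializations.
Variables (K : numFieldType) (m : nat).
Implicit Types (c : cocycle K m) (s : seq K).

Local Notation "s ** t" := (expr_mul s t) (at level 40, left associativity).

Definition off_points s : set (projline K) :=
  [set x | if x is Some w then w \notin s else False].

(** A frame over the complement of [s] and of the point at infinity: [t x]
    expresses it in the trivialization of [c] at [x]. The covering [W] may be
    finer than that of [c], so that a point can be removed from all its members
    but one. *)
Definition trivial_off c s :=
  exists (W : projline K -> set (projline K)) (t : projline K -> expr K m),
  [/\ forall x, open (W x), forall x, W x x, forall x, W x `<=` opn c x,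
      forall x, even_unit (W x `&` off_points s) (t x) &
      forall x y, eq_on (W x `&` W y `&` off_points s) (t x) (trf c x y ** t y)].

Lemma off_points_chartV s : off_points s `<=` @chartV K.
Proof. by case=> [w _|//]; exists w. Qed.

Lemma chartV_off_nil : off_points [::] = @chartV K.
Proof.
by apply/seteqP; split; [exact: off_points_chartV|move=> _ [w _ <-]].
Qed.

Lemma zariski_open_notin s : zariski_open [set x : K | x \notin s].
Proof.
have E x : (\prod_(y <- s) ('X - y%:P)).[x] != 0 <-> x \notin s.
  by rewrite -[_ != 0]/(~~ root _ x) root_prod_XsubC.
by move=> p /E sp; exists (\prod_(y <- s) ('X - y%:P)) => // x /E.
Qed.

Lemma open_setC_ptV (p : K) : open (~` [set ptV p]).
Proof.
split=> [z /= zp|w /= wp].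
  exists (1 - p *: 'X) => [|x]; rewrite !(hornerD, hornerN, hornerZ, hornerX, hornerC).
    apply/eqP => /eqP; rewrite subr_eq0 => /eqP pz.
    have z0 : z != 0 by apply/eqP => z0; move/eqP: pz; rewrite z0 mulr0 oner_eq0.
    apply: zp; rewrite ptU_neq0 //; congr ptV.
    by rewrite -[z^-1]mul1r pz mulfK.
  move=> px /=; rewrite /ptU; case: eqP => // /eqP x0 [xp].
  by move: px; rewrite -xp mulVf // subrr eqxx.
exists ('X - p%:P) => [|x]; rewrite hornerXsubC subr_eq0.
  by apply/eqP => wE; apply: wp; rewrite wE.
by move=> /eqP xp [].
Qed.

(** By the cocycle condition the trivialization at one point is a frame over its
    open set, which is the complement of a finite set. *)
Lemma trivial_off_some c : exists s, trivial_off c s.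
Proof.
pose x0 := @ptV K 0.
have [f f0 fP] := (opn_open c x0).2 0 (opn_mem c x0).
have [s sP] := poly_root_seq (horner_neq0 f0).
have sub : off_points s `<=` opn c x0.
  case=> [w /= ws|//]; apply: fP; apply: contra ws => fw; exact: sP.
exists s, (opn c), (fun x => trf c x x0); split.
- exact: opn_open.
- exact: opn_mem.
- by move=> x y.
- by move=> x; apply: even_unitS (trf_unit c x x0) => y [? /sub].
- move=> x y; apply: eq_on_sym; apply: eq_onS (trf_cocycle c x y x0).
  by move=> z [[? ?] /sub].
Qed.

(** Near [p] a frame off [p] differs from a local frame at [p] by a Laurent
    function that is invertible on the whole chart off [p]; dividing by it
    changes the frame without creating other bad points. *)
Lemma trivial_off_cons c p s : trivial_off c (p :: s) -> trivial_off c s.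
Proof.
have [ps|ps] := boolP (p \in s).
  suff E : off_points (p :: s) = off_points s by rewrite /trivial_off E.
  apply/seteqP; split=> -[w|] //=; rewrite inE negb_or; first by case/andP.
  by move=> ws; rewrite ws andbT; apply: contraNneq ws => ->.
move=> [W [t [oW mW sW ut tt]]].
pose P := @ptV K p.
pose A := [set w | W P (ptV w) /\ w \notin s].
have oA : zariski_open A.
  by apply: zariski_openI; [exact: (oW P).2|exact: zariski_open_notin].
have Ap : A p by split=> //; exact: mW.
have offE w : off_points (p :: s) (ptV w) <-> w != p /\ w \notin s.
  by rewrite /= inE negb_or; split=> [/andP[]|[-> ->]].
have [[[_ tV _] [_ teV]] [t' [[_ tV' _] [_ teV']] [_ tt']]] := ut P.
have sub w : (A `\ p) w -> (W P `&` off_points (p :: s)) (ptV w).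
  by move=> [[Ww ws] wp]; split=> //; apply/offE; split=> //; apply/eqP.
have [| | |B [k [n [u [v [[oB Bp BA] [[nL ru rv] [nP uP fE]]]]]]]] :=
  @local_factor K m A p (t P).2 t'.2 oA Ap.
- by move=> S; apply: regularS (tV S) => w /sub.
- by move=> S; apply: regularS (tV' S) => w /sub.
- move=> w Aw wp; have Dw := sub w (conj Aw (elimN eqP wp)).
  by split; [exact: teV|exact: teV'|exact: tt'].
have offp w : off_points (p :: s) (ptV w) -> w != p by case/offE.
pose hi := of_chartV (fun w => (w - p) ^ (- k) *: geom_inv (n w)).
have rp := regular_fun_ring [set w : K | w != p].
have rn : coefs_in (regular_fun [set w | w != p]) n.
  by move=> S; exact: laurent_regular.
have rX j : regular_fun [set w | w != p] (fun w => (w - p) ^ j).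
  exact/laurent_regular/laurent_at_exp.
have uhi : even_unit (off_points (p :: s)) hi.
  apply: (@of_chartV_even_unit _ _ _ _ (fun w => (w - p) ^ k *: (1 + n w))).
  - exact: off_points_chartV.
  - move=> S; apply: regularS (offp) _; move: S; apply: coefs_inZ => //.
    exact: coefs_in_geom_inv.
  - move=> S; apply: regularS (offp) _; move: S; apply: coefs_inZ => //.
    by apply: coefs_inD => //; exact: coefs_in_cst.
  move=> w /offp wp; have [ne no] := nP w.
  have ge : ext_even (geom_inv (n w)) by exact: geom_inv_even.
  split; first exact: ext_evenZ.
    by apply/ext_evenZ/ext_evenD => //; exact: ext_even1.
  rewrite -scalerAl -scalerAr scalerA -expfzDr ?subr_eq0 // addNr expr0z scale1r.
  by rewrite ext_evenC // geom_invP.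
pose N : set (projline K) := [set x : projline K | if x is Some w then B w else False].
have NV : N `<=` @chartV K by case=> // w _; exists w.
have uu : even_unit N (of_chartV u) by exact: (of_chartV_even_unit NV ru rv).
pose W' x := if x == P then N else W x `&` ~` [set P].
pose t1 x := if x == P then of_chartV u else t x ** hi.
have W'W x : W' x `<=` W x.
  rewrite /W'; case: eqP => [->|_] y; last by case.
  by case: y => // w /BA[].
have W'off x : x <> P -> W' x `&` off_points s `<=` off_points (p :: s).
  move=> /eqP xP; rewrite /W' (negPf xP) => -[w|] [[_ wP] ws] //; apply/offE.
  by split=> //; apply/eqP => wE; apply: wP; rewrite wE.
have t1E x : eq_on (W' x `&` off_points (p :: s)) (t1 x) (t x ** hi).
  rewrite /W' /t1; case: eqP => // ->; apply: eq_on_sym.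
  apply: eq_on_chartV => [y [/NV]//| | |w [Bw /offp wp]] /=.
  - apply: even_unit_section; apply: even_unitM.
      by apply: even_unitS (ut P) => -[w|] [// /BA[]].
    by apply: even_unitS uhi => y [].
  - by apply: even_unit_section; apply: even_unitS uu => y [].
  rewrite fE // -scalerAl -scalerAr scalerA -expfzDr ?subr_eq0 // addrN expr0z scale1r.
  have [ne no] := nP w.
  have e1n : ext_even (1 + n w) by apply: ext_evenD => //; exact: ext_even1.
  by rewrite (ext_evenC _ e1n) -mulrA geom_invP // mulr1.
(* On overlaps that meet [p] only the member [N] at [p] is involved; elsewhere
   both frames are [t] times the same function [hi]. *)
exists W', t1; split.
- move=> x; rewrite /W'; case: eqP => _; first exact: open_chartV_image.
  by apply: openI => //; exact: open_setC_ptV.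
- by move=> x; rewrite /W'; case: eqP => [->//|xP]; split.
- by move=> x y /W'W/sW.
- move=> x; rewrite /t1; case: eqP => [->|xP].
    by apply: even_unitS uu => y []; rewrite /W' eqxx.
  apply: even_unitM.
    by apply: even_unitS (ut x) => y Wy; split; [case: Wy => /W'W|exact: W'off Wy].
  by apply: even_unitS uhi; exact: W'off.
move=> x y; set D := (X in eq_on X).
have [xyP|xyP] := pselect (x = P /\ y = P).
  rewrite xyP.1 xyP.2 -[X in eq_on _ X _]expr_mul1; apply: eq_onM => //.
  apply: eq_on_sym; apply: eq_onS (trf_id c P) => z [[Wz _] _].
  by rewrite -xyP.1; apply/sW/W'W.
have Doff : D `<=` off_points (p :: s).
  move=> z [[Wx Wy] zs].
  have [xP|xP] := pselect (x = P); last exact: (W'off x).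
  by apply: (W'off y) => // yP; exact: xyP.
have Dx : D `<=` W' x `&` off_points (p :: s).
  by move=> z Dz; split; [case: Dz => -[]|exact: Doff].
have Dy : D `<=` W' y `&` off_points (p :: s).
  by move=> z Dz; split; [case: Dz => -[]|exact: Doff].
apply: eq_on_trans (eq_onS Dx (t1E x)) _.
apply: (@eq_on_trans _ _ _ _ (trf c x y ** t y ** hi)).
  apply: eq_onM => //; apply: eq_onS (tt x y) => z Dz; split; last exact: Doff.
  by case: Dz => -[/W'W ? /W'W ?] _.
rewrite -expr_mulA; apply: eq_onM => //; apply: eq_on_sym.
exact: eq_onS Dy (t1E y).
Qed.

Lemma trivial_chartV c : trivial_off c [::].
Proof.
have [s] := trivial_off_some c.
by elim: s => // p s IHs /trivial_off_cons.
Qed.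

(** At infinity the frame over the chart V is a Laurent function of the
    overlap times a local frame, and that Laurent function glues the sheaf. *)
Lemma class_of_glue_laurent c :
  exists (k : int) n
    (hg : even_unit (@overlap K) (of_chartV (fun w => w ^ k *: (1 + n w)))),
  [/\ coefs_in (laurent_at 0) n, forall w, ext_even (n w) /\ ext_order_ge 1 (n w) &
      class_of c = class_of (glue hg)].
Proof.
have [W [t [oW mW sW ut tt]]] := trivial_chartV c; rewrite chartV_off_nil in ut tt.
pose oo : projline K := None.
pose A := @ptU K @^-1` W oo.
have oA : zariski_open A by exact: (oW oo).1.
have A0 : A 0 by rewrite /A /= /ptU eqxx; exact: mW.
have [[[tU _ _] [teU _]] [t' [[tU' _ _] [teU' _]] [tt' _]]] := ut oo.
have sub z : (A `\ 0) z -> (W oo `&` @chartV K) (ptU z).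
  by move=> [Az /eqP z0]; split=> //; apply/chartV_ptU.
have [| | |B [k [n [u [v [[oB B0 BA] [[nL ru rv] [nP uP fE]]]]]]]] :=
  @local_factor K m A 0 (t oo).1 t'.1 oA A0.
- by move=> S; apply: regularS (tU S) => w /sub.
- by move=> S; apply: regularS (tU' S) => w /sub.
- move=> w Aw wp; have Dw := sub w (conj Aw (elimN eqP wp)).
  by split; [exact: teU|exact: teU'|exact: tt'].
(* The Laurent factor, rewritten in the coordinates (w|psi). *)
pose n' w := ext_rescale w (n w^-1).
have n'P w : ext_even (n' w) /\ ext_order_ge 1 (n' w).
  by have [ne no] := nP w^-1; split; [exact: ext_rescale_even|exact: ext_rescale_order].
have lX j : laurent_at 0 (fun w : K => w ^ j).
  have -> : (fun w : K => w ^ j) = (fun w => (w - 0) ^ j).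
    by apply/funext => w; rewrite subr0.
  exact: laurent_at_exp.
have n'L : coefs_in (laurent_at 0) n'.
  have [_ _ lM] := @laurent_ring K 0; move=> S.
  under [X in laurent_at _ X]funext => w do rewrite ext_rescaleE.
  apply: lM; first by move: (lX (- #|S|%:Z)); under [X in laurent_at _ X]funext => w do
    rewrite -exprnN.
  exact: (laurent_inv (nL S)).
have lr := @laurent_ring K 0.
have ovS w : (@ptV K @^-1` @overlap K) w -> w != 0 by move/overlap_ptV.
have OV : @overlap K `<=` @chartV K by move=> x [].
have OU : @overlap K `<=` @chartU K by move=> x [].
have ug : even_unit (@overlap K) (of_chartV (fun w => w ^ (- k) *: (1 + n' w))).
  apply: (@of_chartV_even_unit _ _ _ _ (fun w => w ^ k *: geom_inv (n' w))) => //.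
  - move=> S; apply: regularS ovS _; apply: laurent_regular; move: S.
    by apply: coefs_inZ => //; apply: coefs_inD => //; exact: coefs_in_cst.
  - move=> S; apply: regularS ovS _; apply: laurent_regular; move: S.
    by apply: coefs_inZ => //; exact: coefs_in_geom_inv.
  move=> w /ovS w0; have [ne no] := n'P w; split.
  - by apply/ext_evenZ/ext_evenD => //; exact: ext_even1.
  - exact/ext_evenZ/geom_inv_even.
  by rewrite -scalerAl -scalerAr scalerA -expfzDr // addNr expr0z scale1r geom_invP.
exists (- k), n', ug; split=> //; apply/class_ofP.
pose N : set (projline K) :=
  [set x : projline K | if x is Some w then w != 0 /\ B w^-1 else B 0].
have NE z : N (ptU z) <-> B z.
  rewrite /N /= /ptU; have [->//|z0] := eqVneq z 0.
  by rewrite invr_eq0 invrK; split=> [[]|].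
have NU : N `<=` @chartU K.
  by case=> [w [w0 _]|_]; [apply/chartU_ptV|exists 0 => //; rewrite /ptU eqxx].
have NW : N `<=` W oo.
  move=> x Nx; have [z _ zx] := NU x Nx; rewrite -zx in Nx *.
  by apply: BA; apply/NE.
have uu : even_unit N (of_chartU u).
  apply: (@of_chartU_even_unit _ _ _ _ v) => //.
  - by move=> S; apply: regularS (ru S) => z /NE.
  - by move=> S; apply: regularS (rv S) => z /NE.
  by move=> z /NE/uP.
set g := of_chartV _ in ug *.
have tg : eq_on (N `&` @chartV K) (t oo) (of_chartU u ** g).
  have NO : N `&` @chartV K `<=` @overlap K by move=> x [/NU].
  apply: eq_on_chartU => [x /NO/OU//| | |z [/NE Bz /chartV_ptU z0]] /=.
  - by apply: even_unit_section; apply: even_unitS (ut oo) => x [/NW].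
  - apply: even_unit_section; apply: even_unitM; last exact: even_unitS ug.
    by apply: even_unitS uu => x [].
  have [eu _ _] := uP z Bz.
  rewrite fE // subr0 (ext_evenC _ eu) ext_rescaleZ ext_rescaleD ext_rescale1.
  by rewrite /n' invrK ext_rescaleK // exprz_inv opprK scalerAl.
have [ui gi] := even_unit_invP ug.
exists (fun x => if x is Some _ then W x `&` @chartV K else N).
exists (fun x => if x is Some _ then t x else of_chartU u); split.
- by case=> [w|]; [apply: openI => //; exact: chartV_open|exact: open_chartU_image].
- by case=> [w|//]; split=> //; exists w.
- case=> [w|] x; first by case=> /sW.
  by move=> Nx; split; [exact/sW/NW|exact: NU].
- by case.
case=> [w|] [w'|] /=; rewrite ?expr_mulr1.
- by apply: eq_onS (tt _ _) => x [[? ?] [? ?]].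
- set D := (X in eq_on X).
  have DO : D `<=` @overlap K by move=> x [[_ ?] /NU].
  apply: (@eq_on_trans _ _ _ _
    (trf c (Some w) oo ** (of_chartU u ** g) ** even_unit_inv ug)).
    apply: eq_onM => //; apply: (@eq_on_trans _ _ _ _ (trf c (Some w) oo ** t oo)).
      by apply: eq_onS (tt _ _) => x [[? ?] /NW].
    by apply: eq_onM => //; apply: eq_onS tg => x [[? ?] ?].
  rewrite -!expr_mulA; apply: eq_onM => //.
  by rewrite -[X in eq_on _ _ X]expr_mulr1; apply: eq_onM => //; exact: eq_onS gi.
- apply: (@eq_on_trans _ _ _ _ (t oo)).
    by apply: eq_on_sym; apply: eq_onS tg => x [? [_ ?]].
  by apply: eq_onS (tt _ _) => x [/NW ? [? ?]].
- rewrite -[X in eq_on _ X _]expr_mul1; apply: eq_onM => //; apply: eq_on_sym.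
  by apply: eq_onS (trf_id c oo) => x [/NW/sW].
Qed.

End Trivializations.

(** * Laurent transition functions *)

Section LaurentCocycles.
Variables (K : fieldType) (m : nat).

Local Notation "s ** t" := (expr_mul s t) (at level 40, left associativity).

Definition polynomial_fun (f : K -> K) := exists q : {poly K}, f = horner q.

(** In degree [d] the three terms are regular on V, monomials of the generators,
    and [w^-d] times a function regular on U. *)
Lemma laurent_split d (f : K -> K) : (0 < d)%N -> laurent_at 0 f ->
  exists (q r : {poly K}) (c : nat -> K), forall w, w != 0 ->
    f w = q.[w] + \sum_(1 <= l < d) c l / w ^+ l + w ^- d * r.[w^-1].
Proof.
move=> d0 [a' [k' fE']].
(* Raising the exponent makes room for the [d - 1] middle terms. *)
pose k := (k' + d)%N; pose a := a' * 'X^d.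
have fE w : w != 0 -> f w = a.[w] / w ^+ k.
  move=> w0; rewrite fE' // subr0 /a hornerM hornerXn /k exprD invfM mulrACA.
  by rewrite divff ?mulr1 // expf_neq0.
exists (drop_poly k a), (\poly_(i < k.+1 - d) a`_(k - (i + d))), (fun l => a`_(k - l)).
move=> w w0; have wn j : w ^+ j != 0 by rewrite expf_neq0.
rewrite fE // -{1}[a](poly_take_drop k) hornerD hornerM hornerXn.
rewrite mulrDl mulfK // addrC -addrA; congr (_ + _).
transitivity (\sum_(1 <= l < k.+1) a`_(k - l) / w ^+ l).
  rewrite horner_poly mulr_suml big_add1 /= big_nat_rev /= big_mkord.
  apply: eq_bigr => i _; have ik := ltn_ord i.
  have -> : ((0 + k - i.+1).+1 = k - i)%N by lia.
  rewrite subKn; last exact: ltnW.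
  have -> : w ^+ k = w ^+ i * w ^+ (k - i) by rewrite -exprD subnKC // ltnW.
  by rewrite invfM mulrA mulfK.
rewrite (big_cat_nat (n := d)) //=; last by rewrite /k; lia.
congr (_ + _); rewrite horner_poly mulr_sumr -{1}[d]add0n big_addn big_mkord.
apply: eq_bigr => i _; rewrite exprD invfM exprVn; ring.
Qed.

Lemma nilpotent_part_laurent (c : {set 'I_m} -> nat -> K) :
  coefs_in (laurent_at 0) (nilpotent_part c).
Proof.
have lr := @laurent_ring K 0.
do 3!apply: coefs_in_sum => // ? _; apply: coefs_inZ => //; last exact: coefs_in_cst.
by eexists _%:P, _ => x _; rewrite hornerC subr0.
Qed.

Lemma of_chartV_laurent_unit (n : K -> ext K m) : coefs_in (laurent_at 0) n ->
  (forall w, w != 0 -> ext_even (n w) /\ ext_order_ge 1 (n w)) ->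
  even_unit (@overlap K) (of_chartV (fun w => 1 + n w)).
Proof.
move=> nL nP; have lr := @laurent_ring K 0.
have ovS w : (@ptV K @^-1` @overlap K) w -> w != 0 by move/overlap_ptV.
apply: (@of_chartV_even_unit _ _ _ _ (fun w => geom_inv (n w))).
- by move=> x [].
- move=> S; apply: regularS ovS _; apply: laurent_regular; move: S.
  by apply: coefs_inD => //; exact: coefs_in_cst.
- move=> S; apply: regularS ovS _; apply: laurent_regular; move: S.
  exact: coefs_in_geom_inv.
move=> w /ovS /nP[ne no]; split; last exact: geom_invP.
  by apply: ext_evenD => //; exact: ext_even1.
exact: geom_inv_even.
Qed.

(** A Laurent monomial of degree [d] in the odd variables is regular on V
    ([w^i psi^S] with [i >= 0]), or regular on U
    ([w^-l psi^S = z^(l - d) theta^S] with [l >= d]), or, when [d] is even, one of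
    the monomials of the generators. *)
Lemma laurent_leading_split d (n : K -> ext K m) : (0 < d)%N -> ~~ odd d ->
  coefs_in (laurent_at 0) n -> (forall w, w != 0 -> ext_order_ge d (n w)) ->
  exists (a b : K -> ext K m) (c : {set 'I_m} -> nat -> K),
  [/\ coefs_in polynomial_fun a,
      coefs_in polynomial_fun b,
      forall w, ext_homogeneous d (a w) /\ ext_homogeneous d (b w),
      forall w, ext_homogeneous d (nilpotent_part c w) &
      forall w, w != 0 -> ext_order_ge d.+1
        (n w - (a w + ext_rescale w (b w^-1) + nilpotent_part c w))].
Proof.
move=> d0 ed nL no.
have /choice[q qP] S := laurent_split d0 (nL S).
have /choice[r rP] := qP; have /choice[c cP] := rP.
pose trunc (p : {set 'I_m} -> {poly K}) w : ext K m :=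
  [ffun S : {set 'I_m} => if #|S| == d then (p S).[w] else 0].
have trunc_poly p : coefs_in polynomial_fun (trunc p).
  move=> S; exists (if #|S| == d then p S else 0); apply/funext => w.
  by rewrite ffunE; case: eqP; rewrite ?horner0.
have trunc_hom p w : ext_homogeneous d (trunc p w).
  by move=> S nS; rewrite ffunE (negPf nS).
exists (trunc q), (trunc r).
exists (fun (S : {set 'I_m}) l => if #|S| == d then c S l else 0); split=> //.
  move=> w S nS; rewrite nilpotent_partE (negPf nS); case: ifP => // _.
  by rewrite big1 // => l _; rewrite mul0r.
move=> w w0 S; rewrite ltnS leq_eqVlt !(extDE, extNE) => /orP[/eqP Sd|Sd].
  rewrite nilpotent_partE Sd ed ext_rescaleE !ffunE Sd eqxx cP //.
  by rewrite [X in _ - X]addrAC subrr.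
have nS : #|S| != d by rewrite ltn_eqF.
rewrite no // nilpotent_partE ext_rescaleE !ffunE (negPf nS) mulr0 !add0r.
by case: ifP => _; rewrite ?oppr0 // big1 ?oppr0 // => l _; rewrite mul0r.
Qed.

End LaurentCocycles.

Arguments polynomial_fun {K}.

Section Generation.
Variables (K : fieldType) (m : nat) (H : set (Pic0 K m)).
Hypothesis HM : forall x y, H x -> H y -> H (Pic0_mul x y).
Hypothesis Hw : forall k, H (class_of (glue (w_power_unit K m k))).
Hypothesis Hc : forall c, H (class_of (glue (unipotent_unit c))).

Local Notation "s ** t" := (expr_mul s t) (at level 40, left associativity).

Let homogeneous_order d (a : ext K m) : ext_homogeneous d a -> ext_order_ge d a.
Proof. by move=> ha S Sd; apply: ha; rewrite ltn_eqF. Qed.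

Let homogeneous_even d (a : ext K m) : ~~ odd d -> ext_homogeneous d a -> ext_even a.
Proof. by move=> ed ha S oS; apply: ha; apply: contraNneq ed => <-. Qed.

(** Write [a], [y] and [b'] for the terms of degree [d] of [n] that are regular on
    V, monomials of the generators, and regular on U. The quotient of [1 + n] by
    [(1 + b') (1 + y) (1 + a)] is [1 + n1] with [n1] of order at least [d + 1]: the
    terms of degree [d] cancel, and products of two of them have degree [2 d > d].
    The factors [1 + b'] and [1 + a] extend to U and V and do not change the class.
    The induction is on the number [e] of degrees left before [n] must vanish. *)
Lemma unipotent_laurent_generated e d (n : K -> ext K m)
    (hg : even_unit (@overlap K) (of_chartV (fun w => 1 + n w))) :
  (m < d + e)%N -> (0 < d)%N -> coefs_in (laurent_at 0) n ->
  (forall w, w != 0 -> ext_even (n w) /\ ext_order_ge d (n w)) ->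
  H (class_of (glue hg)).
Proof.
elim: e d n hg => [|e IHe] d n hg md d0 nL nP.
  rewrite (class_of_glue_eq hg (w_power_unit K m 0) (even_unit1 _ _) (even_unit1 _ _)) //.
  rewrite expr_mul1 expr_mulr1; apply: eq_on_chartV => [x []//| | |w /overlap_ptV w0].
  - exact: even_unit_section (w_power_unit K m 0).
  - exact: even_unit_section hg.
  have [_ no] := nP w w0; rewrite /= expr0z scale1r.
  rewrite (ext_order_ge_big (a := n w)) ?addr0 //.
  by apply: ext_order_geW no; rewrite addn0 in md.
have [od|ed] := boolP (odd d).
  apply: (IHe d.+1) => // [|w w0]; first by rewrite addSnnS.
  have [ne no] := nP w w0; split=> // S; rewrite ltnS leq_eqVlt => /orP[/eqP Sd|/no//].
  by rewrite ne // Sd.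
have [|a [b [c [ap bp abh ch ncd]]]] := laurent_leading_split d0 ed nL.
  by move=> w /nP[].
pose b' w := ext_rescale w (b w^-1); pose y := nilpotent_part c.
pose G w := geom_inv (a w) * (geom_inv (y w) * geom_inv (b' w)).
pose n1 w := (1 + n w) * G w - 1.
have [ae ao] : (forall w, ext_even (a w)) /\ (forall w, ext_order_ge d (a w)).
  by split=> w; have [ha _] := abh w;
    [exact: homogeneous_even ha|exact: homogeneous_order].
have [be bo] : (forall w, ext_even (b w)) /\ (forall w, ext_order_ge d (b w)).
  by split=> w; have [_ hb] := abh w;
    [exact: homogeneous_even hb|exact: homogeneous_order].
have b'e w : ext_even (b' w) by exact: ext_rescale_even.
have b'o w : ext_order_ge d (b' w) by exact: ext_rescale_order.
have ye w : ext_even (y w) by exact: homogeneous_even (ch w).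
have yo w : ext_order_ge d (y w) by exact: homogeneous_order.
have o1 (x : ext K m) : ext_order_ge d x -> ext_order_ge 1 x by exact: ext_order_geW.
have e1 (x : ext K m) : ext_even x -> ext_even (1 + x).
  by apply: ext_evenD; exact: ext_even1.
have lr := @laurent_ring K 0.
have poly_in (P : (K -> K) -> Prop) (f : K -> ext K m) :
    (forall q : {poly K}, P (horner q)) ->
    coefs_in polynomial_fun f -> coefs_in P f.
  by move=> Pq fq S; have [q ->] := fq S.
have pl (q : {poly K}) : laurent_at 0 (horner q).
  by exists q, 0%N => x _; rewrite expr0 divr1.
have aL : coefs_in (laurent_at 0) a by exact: poly_in ap.
have b'L : coefs_in (laurent_at 0) b'.
  have [_ _ lM] := lr; move=> S; have bS := poly_in _ _ pl bp S.
  under [X in laurent_at _ X]funext => w do rewrite ext_rescaleE.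
  apply: lM; last exact: (laurent_inv bS).
  by exists 1, #|S| => w _; rewrite hornerC subr0 div1r.
have yL : coefs_in (laurent_at 0) y by exact: nilpotent_part_laurent.
have GL : coefs_in (laurent_at 0) G.
  by do ![apply: coefs_inM => //]; exact: coefs_in_geom_inv.
have GE w : ext_even (G w).
  by do ![apply: ext_evenM]; exact: geom_inv_even.
have X'G w : (1 + b' w) * (1 + y w) * (geom_inv (y w) * geom_inv (b' w)) = 1.
  rewrite -mulrA (mulrA (1 + y w)) geom_invP; last exact: o1.
  by rewrite mul1r geom_invP //; exact: o1.
have XG w : (1 + b' w) * (1 + y w) * (1 + a w) * G w = 1.
  rewrite /G -mulrA (mulrA (1 + a w)) geom_invP; last exact: o1.
  by rewrite mul1r X'G.
have n1L : coefs_in (laurent_at 0) n1.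
  apply: coefs_inD => //; last exact: coefs_in_cst.
  by apply: coefs_inM => //; apply: coefs_inD => //; exact: coefs_in_cst.
have n1P w : w != 0 -> ext_even (n1 w) /\ ext_order_ge d.+1 (n1 w).
  move=> w0; have [ne no] := nP w w0; split.
    by apply/ext_evenD/ext_evenN/ext_even1/ext_evenM/GE/e1.
  rewrite /n1 -{2}(XG w) -mulrBl -[d.+1]addn0; apply: ext_order_geM => //.
  have oM (x x' : ext K m) : ext_order_ge d x -> ext_order_ge d x' ->
      ext_order_ge d.+1 (x * x').
    move=> ox ox'; apply: ext_order_geW (ext_order_geM ox ox').
    by rewrite -addn1 leq_add2l.
  pose z := b' w + y w + b' w * y w.
  have zo : ext_order_ge d z.
    do ![apply: ext_order_geD => //].
    by apply: ext_order_geW (oM _ _ _ _) => //.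
  (* The elements of the exterior algebra need not commute, so the products are
     treated as constants and the identity is checked on coefficients. *)
  have -> : 1 + n w - (1 + b' w) * (1 + y w) * (1 + a w) =
      n w - (a w + b' w + y w) + (- (b' w * y w) + - (z * a w)).
    rewrite /z !(mulrDl, mulrDr, mul1r, mulr1); apply/ffunP => S.
    by rewrite !(extDE, extNE); ring.
  apply: ext_order_geD; first exact: ncd.
  by apply: ext_order_geD; apply: ext_order_geN; exact: oM.
have hn1 : even_unit (@overlap K) (of_chartV (fun w => 1 + n1 w)).
  apply: of_chartV_laurent_unit => // w w0; have [? o] := n1P w w0; split=> //.
  exact: ext_order_geW o.
pose A := of_chartU (fun z => 1 + b z); pose B := of_chartV (fun w => geom_inv (a w)).
have uA : even_unit (@chartU K) A.
  have rp := regular_fun_ring (@ptU K @^-1` @chartU K).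
  have rb : coefs_in (regular_fun (@ptU K @^-1` @chartU K)) b.
    by apply: poly_in bp => q; exact: regular_poly.
  apply: (@of_chartU_even_unit _ _ _ _ (fun z => geom_inv (b z))) => //.
  - by apply: coefs_inD => //; exact: coefs_in_cst.
  - exact: coefs_in_geom_inv.
  - by move=> z _; split; [exact: e1|exact: geom_inv_even|exact/geom_invP/o1].
have uB : even_unit (@chartV K) B.
  have rp := regular_fun_ring (@ptV K @^-1` @chartV K).
  have ra : coefs_in (regular_fun (@ptV K @^-1` @chartV K)) a.
    by apply: poly_in ap => q; exact: regular_poly.
  apply: (@of_chartV_even_unit _ _ _ _ (fun z => 1 + a z)) => //.
  - exact: coefs_in_geom_inv.
  - by apply: coefs_inD => //; exact: coefs_in_cst.
  move=> z _; have ge : ext_even (geom_inv (a z)) by exact: geom_inv_even.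
  by split=> //; [exact: e1|rewrite ext_evenC //; exact/geom_invP/o1].
rewrite (class_of_glue_eq hg (even_unitM (unipotent_unit c) hn1) uA uB).
  rewrite (class_of_glueM (unipotent_unit c) hn1); apply: HM => //.
  by apply: (IHe d.+1) => //; rewrite addSnnS.
have OU : @overlap K `<=` @chartU K by move=> x [].
have OV : @overlap K `<=` @chartV K by move=> x [].
apply: eq_on_chartV => // [| |w /overlap_ptV w0] /=.
- apply: even_unit_section; apply: even_unitM (even_unitS OU uA) _.
  exact: even_unitM (unipotent_unit c) hn1.
- exact: even_unit_section (even_unitM hg (even_unitS OV uB)).
have [ne _] := nP w w0.
have -> : 1 + n1 w = (1 + n w) * G w by rewrite /n1 addrC subrK.
rewrite ext_rescaleD ext_rescale1 -/(b' w) -/(y w) /G !mulrA.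
have ev : ext_even ((1 + b' w) * (1 + y w)) by apply: ext_evenM; exact: e1.
rewrite -(mulrA _ (1 + n w)) (ext_evenC _ ev) -!mulrA (mulrA (1 + b' w)) X'G.
by rewrite mulr1.
Qed.

End Generation.

Theorem theorem3 (R : realType) (m : nat) :
  generated_subgroup
    ([set class_of (glue (w_power_unit R[i] m k)) | k in [set: int]] `|`
     [set class_of (glue (unipotent_unit c))
        | c in [set: {set 'I_m} -> nat -> R[i]]])
  = [set: Pic0 R[i] m].
Proof.
apply/seteqP; split=> // x _ H [Hgroup gen].
have HM p q : H p -> H q -> H (Pic0_mul p q).
  by move=> /mem_set Hp /mem_set Hq; apply/set_mem; exact: (group_closedM Hgroup).
have Hw k : H (class_of (glue (w_power_unit R[i] m k))).
  by apply: gen; left; exists k.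
have Hc c : H (class_of (glue (unipotent_unit c))).
  by apply: gen; right; exists c.
have [c ->] := class_of_surj x.
have [k [n [hg [nL nP ->]]]] := class_of_glue_laurent c.
have hn := of_chartV_laurent_unit nL (fun w _ => nP w).
rewrite (class_of_glue_eq hg (even_unitM (w_power_unit R[i] m k) hn)
  (even_unit1 _ _) (even_unit1 _ _)).
  rewrite (class_of_glueM (w_power_unit R[i] m k) hn); apply: (HM) => //.
  by apply: (unipotent_laurent_generated HM Hw Hc (e := m) (d := 1)) => // w _; exact: nP.
rewrite expr_mul1 expr_mulr1; apply: eq_on_chartV => [y []//| | |w _] /=.
- exact: even_unit_section (even_unitM (w_power_unit R[i] m k) hn).
- exact: even_unit_section hg.
by rewrite -scalerAl mul1r.
Qed.
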